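(* Let $\Lambda=kQ/I$ be a bound quiver algebra of infinite global dimension. (1) If for each pair of vertices $y,x\in Q_0$ we have $y\Lambda x\neq 0$ and $x\Lambda y\neq 0$, then $\Lambda$ is of infinite + global dimension and of infinite co+ global dimension. (2) If for each pair of vertices $y,x\in Q_0$ we have $y\Lambda x\neq 0$ or $x\Lambda y\neq 0$ (or both), then $\Lambda$ is of infinite + global dimension or of infinite co+ global dimension (or both).
   Context: Let $k$ be a field. Bound quiver algebra: $Q$ is a finite quiver with vertex set $Q_0$, $F$ is the ideal of $kQ$ generated by the arrows, $I$ is an admissible ideal ($F^m\subset I\subset F^2$ for some $m\ge 2$), and $\Lambda=kQ/I$. Paths are composed from right to left, so vertices are idempotents and $y\Lambda x$ is spanned by the classes of paths from $x$ to $y$. For $x\in Q_0$, ${}_xk$ (resp. $k_x$) is the simple left (resp. right) $\Lambda$-module at $x$. A graded vector space $V_*$ is infinite if $V_n\neq 0$ for infinitely many $n$. $\Lambda$ has infinite + global dimension (resp. infinite co+ global dimension) if there is a pair of vertices $(y,x)$ with $y\Lambda x\neq 0$ and $\mathrm{Tor}^\Lambda_*(k_x,{}_yk)$ infinite (resp. $y\Lambda x\ne 0$ and $\mathrm{Tor}^\Lambda_*(k_y,{}_xk)$ infinite). *)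

(* Defs.v *)
From HB Require Import structures.
From mathcomp Require Import all_boot all_order all_algebra.
From mathcomp Require Import generic_quotient ring_quotient.
From mathcomp Require Import mathcomp_extra boolp classical_sets functions.
From mathcomp Require Import cardinality fsbigop.

Set Implicit Arguments.
Unset Strict Implicit.
Unset Printing Implicit Defensive.

Import GRing.Theory.
Local Open Scope classical_set_scope.
Local Open Scope ring_scope.
Local Open Scope quotient_scope.

(* R^(X): the free R-module on X, as the finitely supported functions X -> R.
   It is used for kQ (X the paths, R = k), for free modules over kQ/I, and for
   the free abelian group underlying a tensor product. *)
Section FreeModule.
Variables (R : pzRingType) (X : choiceType).

Definition finsupp : {pred X -> R^o} :=
  fun a => `[< finite_set [set x | a x != 0] >].

Lemma finsuppP (a : X -> R^o) :
  reflect (finite_set [set x | a x != 0]) (a \in finsupp).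
Proof. exact: asboolP. Qed.

Lemma finsupp_submod : submod_closed finsupp.
Proof.
split; first by apply/finsuppP; apply: sub_finite_set (finite_set0 X) => x /=;
  rewrite eqxx.
move=> c a b /finsuppP fa /finsuppP fb; apply/finsuppP.
have fab : finite_set ([set x | a x != 0] `|` [set x | b x != 0]).
  by rewrite finite_setU.
apply: sub_finite_set fab => x /= /eqP nz.
have [a0|] := eqVneq (a x) 0; last by left.
have [b0|] := eqVneq (b x) 0; last by right.
by case: nz; rewrite fctE /= -[(c *: a) x]/(c *: a x) a0 b0 scaler0 addr0.
Qed.

HB.instance Definition _ :=
  GRing.isSubmodClosed.Build R (X -> R^o) finsupp finsupp_submod.

Record freemod := Freemod { coefs : X -> R^o; coefsP : coefs \in finsupp }.

HB.instance Definition _ := [isSub for coefs].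
HB.instance Definition _ := [Choice of freemod by <:].
HB.instance Definition _ := [SubChoice_isSubLmodule of freemod by <:].

End FreeModule.

Arguments finsupp : clear implicits.

Section FreeModuleTheory.
Variables (R : pzRingType) (X : choiceType).
Local Notation freemod := (freemod R X).

(* Scaling in the codomain needs the regular module R^o, but coefficients are
   wanted in R itself. *)
Definition coef (a : freemod) (x : X) : R := coefs a x.
Coercion coef : freemod >-> Funclass.

Arguments coef : simpl never.

Lemma coefD (a b : freemod) x : (a + b) x = a x + b x. Proof. by []. Qed.
Lemma coefZ c (a : freemod) x : (c *: a) x = c * a x. Proof. by []. Qed.
Lemma coef0 x : (0 : freemod) x = 0. Proof. by []. Qed.
Lemma coefB (a b : freemod) x : (a - b) x = a x - b x. Proof. by []. Qed.

Lemma freemodP (a b : freemod) : (forall x, a x = b x) -> a = b.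
Proof. by move=> ab; apply: val_inj; apply/funext. Qed.

Fact fbasis_subproof x : (fun y => (y == x)%:R : R^o) \in finsupp R X.
Proof.
apply/finsuppP; apply: sub_finite_set (finite_set1 x) => y /=.
by case: (eqVneq y x) => //= _; rewrite eqxx.
Qed.
Definition fbasis x : freemod := Freemod (fbasis_subproof x).

Lemma fbasisE x y : fbasis x y = (y == x)%:R. Proof. by []. Qed.

Lemma fsupp_seq (a : freemod) :
  exists2 s : seq X, uniq s & forall x, a x != 0 -> x \in s.
Proof.
have /finsuppP/finite_seqP[s sE] := coefsP a.
exists (undup s); first exact: undup_uniq.
move=> x ax; rewrite mem_undup.
by have : [set x | a x != 0] x by []; rewrite sE.
Qed.

Section Lift.
Variables (M : lmodType R) (f : X -> M).

Definition flift (a : freemod) : M := \sum_(x \in [set: X]) a x *: f x.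

Lemma fliftE (s : seq X) (a : freemod) :
  uniq s -> (forall x, a x != 0 -> x \in s) ->
  flift a = \sum_(x <- s) a x *: f x.
Proof.
move=> us sP; rewrite /flift (fsbigE s) //.
  by apply: eq_bigl => x; rewrite in_setT.
move=> x _; have [->|/sP ->//] := eqVneq (a x) 0.
by rewrite scale0r.
Qed.

Lemma flift_is_linear : linear flift.
Proof.
move=> c a b; have [s us sP] := fsupp_seq a; have [t ut tP] := fsupp_seq b.
pose r := undup (s ++ t).
have ur : uniq r by apply: undup_uniq.
have rP x : a x != 0 \/ b x != 0 -> x \in r.
  by rewrite mem_undup mem_cat => -[/sP ->//|/tP ->]; rewrite orbT.
have aP x : a x != 0 -> x \in r by move=> ax; apply: rP; left.
have bP x : b x != 0 -> x \in r by move=> bx; apply: rP; right.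
have abP x : (c *: a + b) x != 0 -> x \in r.
  rewrite coefD coefZ; have [->|ax _] := eqVneq (a x) 0; last exact: aP.
  by rewrite mulr0 add0r; apply: bP.
rewrite (fliftE ur aP) (fliftE ur bP) (fliftE ur abP).
rewrite scaler_sumr -big_split /=; apply: eq_bigr => x _.
by rewrite coefD coefZ scalerDl scalerA.
Qed.

HB.instance Definition _ :=
  GRing.isLinear.Build R freemod M *:%R flift flift_is_linear.

Lemma flift_basis x : flift (fbasis x) = f x.
Proof.
rewrite (@fliftE [:: x]) // ?big_seq1 ?fbasisE ?eqxx ?scale1r // => y.
by rewrite fbasisE inE; case: (y == x) => //=; rewrite eqxx.
Qed.

End Lift.

Lemma freemod_ind (P : freemod -> Prop) :
  P 0 -> (forall c x a, P a -> P (c *: fbasis x + a)) -> forall a, P a.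
Proof.
move=> P0 PS a; have [s us sP] := fsupp_seq a.
suff -> : a = \sum_(x <- s) a x *: fbasis x.
  by elim: s {us sP} => [|x s IH]; rewrite ?big_nil // big_cons; apply: PS.
rewrite -(fliftE fbasis us sP); apply: freemodP => y.
have [yx|ny] := boolP (y \in s).
  rewrite (fliftE _ us sP) (bigD1_seq y) //= coefD coefZ fbasisE eqxx mulr1.
  rewrite -[LHS]addr0; congr (_ + _); elim: (s) => [|z t IH].
    by rewrite big_nil.
  rewrite big_cons; case: eqVneq => //= nzy.
  by rewrite coefD coefZ fbasisE eq_sym (negbTE nzy) mulr0 add0r.
rewrite (fliftE _ us sP); have -> : a y = 0.
  by apply/eqP; apply: contraNT ny; apply: sP.
elim: (s) (ny) => [|z t IH]; first by rewrite big_nil.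
rewrite inE negb_or => /andP[nyz nyt].
by rewrite big_cons coefD coefZ fbasisE (negbTE nyz) mulr0 add0r IH.
Qed.

Lemma freemod_linear_ext (M : lmodType R) (f g : {linear freemod -> M}) :
  (forall x, f (fbasis x) = g (fbasis x)) -> forall a, f a = g a.
Proof.
move=> fg; elim/freemod_ind => [|c x a IH]; first by rewrite !raddf0.
by rewrite !linearP fg IH.
Qed.

Lemma flift_linear_fun (M : lmodType R) (c : R) (f g : X -> M) a :
  (forall b m, c *: (b *: m) = b *: (c *: m) :> M) ->
  flift (fun x => c *: f x + g x) a = c *: flift f a + flift g a.
Proof.
move=> cC; have [s us sP] := fsupp_seq a; rewrite !(fliftE _ us sP).
rewrite scaler_sumr -big_split; apply: eq_bigr => x _ /=.
by rewrite scalerDr cC.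
Qed.

End FreeModuleTheory.

Section Subgroups.
Variable G : zmodType.

Definition addspan (S : set G) : set G :=
  [set x | forall H : set G,
     H 0 -> (forall u v, H u -> H v -> H (u - v)) -> S `<=` H -> H x].

Definition addspan_pred (S : set G) : {pred G} := fun x => `[< addspan S x >].

Lemma addspan_predP S x : reflect (addspan S x) (x \in addspan_pred S).
Proof. exact: asboolP. Qed.

Lemma addspan_zmod S : zmod_closed (addspan_pred S).
Proof.
split=> [|x y /addspan_predP xS /addspan_predP yS]; apply/addspan_predP.
  by move=> H.
by move=> H H0 HB HS; apply: (HB); [apply: xS | apply: yS].
Qed.

HB.instance Definition _ S :=
  GRing.isZmodClosed.Build G (addspan_pred S) (addspan_zmod S).

Lemma sub_addspan S : S `<=` addspan S.
Proof. by move=> x Sx H _ _; apply. Qed.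

End Subgroups.

Section TwoSidedIdeals.
Variable R : pzRingType.

Record ideal := Ideal {
  ideal_set :> R -> Prop;
  ideal0 : ideal_set 0;
  idealB : forall u v, ideal_set u -> ideal_set v -> ideal_set (u - v);
  idealMl : forall a u, ideal_set u -> ideal_set (a * u);
  idealMr : forall a u, ideal_set u -> ideal_set (u * a) }.

Definition gen_ideal (S : set R) : ideal.
Proof.
exists (fun x => forall J : ideal, (forall s, S s -> J s) -> J x).
- by move=> J _; apply: ideal0.
- by move=> u v uS vS J SJ; apply: idealB; [apply: uS | apply: vS].
- by move=> a u uS J SJ; apply: idealMl; apply: uS.
- by move=> a u uS J SJ; apply: idealMr; apply: uS.
Defined.

Definition ideal_prod (J K : set R) : set R :=
  addspan [set x | exists a b, [/\ J a, K b & x = a * b]].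

(* J^0 is the whole ring, so J^1 = J R = J for an ideal J. *)
Fixpoint ideal_pow (J : set R) (m : nat) : set R :=
  if m is m'.+1 then ideal_prod J (ideal_pow J m') else setT.

Variable J : ideal.

Definition ideal_pred : {pred R} := fun x => `[< J x >].

Lemma ideal_predP x : reflect (J x) (x \in ideal_pred).
Proof. exact: asboolP. Qed.

Lemma ideal_zmod : zmod_closed ideal_pred.
Proof.
split=> [|x y /ideal_predP xJ /ideal_predP yJ]; apply/ideal_predP.
  exact: ideal0.
exact: idealB.
Qed.

HB.instance Definition _ := GRing.isZmodClosed.Build R ideal_pred ideal_zmod.

Definition quotring : Type := Quotient.quot ideal_pred.
HB.instance Definition _ := GRing.Zmodule.on quotring.

Definition qproj (x : R) : quotring := \pi_(Quotient.quot ideal_pred) x.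
Definition qrepr (x : quotring) : R := repr (x : (Quotient.quot ideal_pred)).

Lemma qreprK x : qproj (qrepr x) = x. Proof. exact: reprK. Qed.

Lemma qproj_eqP x y : qproj x = qproj y <-> J (x - y).
Proof.
split; first by move/eqP; rewrite -Quotient.idealrBE => /ideal_predP.
by move=> /ideal_predP h; apply/eqP; rewrite -Quotient.idealrBE.
Qed.

Lemma qreprP x : J (qrepr (qproj x) - x).
Proof. by apply/qproj_eqP; rewrite qreprK. Qed.

Lemma qproj_is_zmod_morphism : zmod_morphism qproj.
Proof. exact: (raddfB \pi_(Quotient.quot ideal_pred)). Qed.
HB.instance Definition _ :=
  GRing.isZmodMorphism.Build R quotring qproj qproj_is_zmod_morphism.

Definition qmul (x y : quotring) : quotring := qproj (qrepr x * qrepr y).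

Lemma qmulE x y : qmul (qproj x) (qproj y) = qproj (x * y).
Proof.
apply/qproj_eqP.
set x' := qrepr _; set y' := qrepr _.
have -> : x' * y' - x * y = (x' - x) * y' - x * (y - y').
  by rewrite mulrBl mulrBr opprB addrA subrK.
apply: idealB; first by apply: idealMr; apply: qreprP.
by apply: idealMl; rewrite -opprB -[- _]sub0r; apply: idealB;
  [apply: ideal0 | apply: qreprP].
Qed.

Lemma qmulA : associative qmul.
Proof.
by move=> x y z; rewrite -[x]qreprK -[y]qreprK -[z]qreprK !qmulE mulrA.
Qed.
Lemma qmul1 : left_id (qproj 1) qmul.
Proof. by move=> x; rewrite -[x]qreprK qmulE mul1r. Qed.
Lemma q1mul : right_id (qproj 1) qmul.
Proof. by move=> x; rewrite -[x]qreprK qmulE mulr1. Qed.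
Lemma qmulDl : left_distributive qmul +%R.
Proof.
move=> x y z; rewrite -[x]qreprK -[y]qreprK -[z]qreprK.
by rewrite -raddfD !qmulE -raddfD mulrDl.
Qed.
Lemma qmulDr : right_distributive qmul +%R.
Proof.
move=> x y z; rewrite -[x]qreprK -[y]qreprK -[z]qreprK.
by rewrite -raddfD !qmulE -raddfD mulrDr.
Qed.

HB.instance Definition _ :=
  GRing.Zmodule_isPzRing.Build quotring qmulA qmul1 q1mul qmulDl qmulDr.

Lemma qproj_is_monoid_morphism : monoid_morphism qproj.
Proof. by split=> // x y; rewrite -qmulE. Qed.
HB.instance Definition _ :=
  GRing.isMonoidMorphism.Build R quotring qproj qproj_is_monoid_morphism.

End TwoSidedIdeals.

Record quiver := Quiver {
  vertex : finType;
  arrow : finType;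
  src : arrow -> vertex;
  tgt : arrow -> vertex }.
Coercion vertex : quiver >-> finType.

Section Paths.
Variable Q : quiver.

(* [is_walk x w]: the arrows of w, listed in the order in which they are
   traversed, form a path starting at x; [walk_end x w] is its endpoint.  The
   path usually written a_n ... a_1 is thus the sequence [:: a_1; ...; a_n]. *)
Fixpoint is_walk (x : Q) (w : seq (arrow Q)) : bool :=
  if w is a :: w' then (src a == x) && is_walk (tgt a) w' else true.

Fixpoint walk_end (x : Q) (w : seq (arrow Q)) : Q :=
  if w is a :: w' then walk_end (tgt a) w' else x.

Definition qpath := {p : Q * seq (arrow Q) | is_walk p.1 p.2}.

Definition pstart (p : qpath) : Q := (val p).1.
Definition pwalk (p : qpath) : seq (arrow Q) := (val p).2.
Definition pend (p : qpath) : Q := walk_end (pstart p) (pwalk p).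

Definition ptriv (x : Q) : qpath := exist _ (x, [::]) isT.

Fact parrow_subproof (a : arrow Q) : is_walk (src a) [:: a].
Proof. by rewrite /= eqxx. Qed.
Definition parrow (a : arrow Q) : qpath :=
  exist _ (src a, [:: a]) (parrow_subproof a).

(* The composite p q: first q, then p. *)
Definition pcomp (p q : qpath) : option qpath :=
  if pend q == pstart p then (insub (pstart q, pwalk q ++ pwalk p) : option qpath)
  else None.

Lemma is_walk_cat x w w' :
  is_walk x (w ++ w') = is_walk x w && is_walk (walk_end x w) w'.
Proof. by elim: w x => //= a w IH x; rewrite IH andbA. Qed.

Lemma walk_end_cat x w w' :
  walk_end x (w ++ w') = walk_end (walk_end x w) w'.
Proof. by elim: w x => //=. Qed.

Lemma pcompP p q r : pcomp p q = Some r <->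
  pend q = pstart p /\ val r = (pstart q, pwalk q ++ pwalk p).
Proof.
rewrite /pcomp; split.
  by case: eqP => // qp; case: insubP => //= u _ <- [<-].
case=> /eqP qp rE; rewrite qp; case: insubP => [u _|].
  by move=> uE; congr Some; apply: val_inj; rewrite uE.
by rewrite -rE (valP r).
Qed.

Lemma pcomp_defined p q : pend q = pstart p -> exists r, pcomp p q = Some r.
Proof.
move=> qp; have h : is_walk (pstart q) (pwalk q ++ pwalk p).
  rewrite is_walk_cat; apply/andP; split; first exact: (valP q).
  by rewrite -/(pend q) qp; exact: (valP p).
by exists (exist _ (pstart q, pwalk q ++ pwalk p) h); apply/pcompP.
Qed.

Lemma pcompE p q r : pcomp p q = Some r ->
  [/\ pstart r = pstart q, pend r = pend p & pwalk r = pwalk q ++ pwalk p].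
Proof.
move=> /pcompP[qp rE]; rewrite /pend /pstart /pwalk rE /=; split=> //.
by rewrite walk_end_cat -/(pend q) qp.
Qed.

Lemma pcompA p q r :
  obind (pcomp p) (pcomp q r) = obind (fun s => pcomp s r) (pcomp p q).
Proof.
have Nend s t : pend t <> pstart s -> pcomp s t = None.
  by rewrite /pcomp => /eqP/negbTE ->.
have [qr|nqr] := eqVneq (pend r) (pstart q); last first.
  rewrite (Nend q r); last exact/eqP.
  case E: (pcomp p q) => [s|] //=; rewrite Nend //.
  by case/pcompE: E => -> _ _; apply/eqP.
have [pq|npq] := eqVneq (pend q) (pstart p); last first.
  rewrite (Nend p q); last exact/eqP.
  case E: (pcomp q r) => [s|] //=; rewrite Nend //.
  by case/pcompE: E => _ -> _; apply/eqP.
have [s sE] := pcomp_defined qr; have [t tE] := pcomp_defined pq.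
rewrite sE tE /=; have [ss se sw] := pcompE sE; have [ts te tw] := pcompE tE.
have [u uE] : exists u, pcomp p s = Some u.
  by apply: pcomp_defined; rewrite se.
rewrite uE; apply/esym/pcompP; split; first by rewrite ts.
have [us _ uw] := pcompE uE.
have -> : val u = (pstart u, pwalk u) by rewrite /pstart /pwalk; case: (val u).
by rewrite us uw ss sw tw catA.
Qed.

Lemma pcomp_trivl x p : pcomp (ptriv x) p = if pend p == x then Some p else None.
Proof.
case: eqP => [px|npx]; last by rewrite /pcomp /=; case: eqP.
apply/pcompP; split=> //; rewrite cats0 /pstart /pwalk.
by case: (val p).
Qed.

Lemma pcomp_trivr x p :
  pcomp p (ptriv x) = if x == pstart p then Some p else None.
Proof.
case: eqP => [px|npx]; last by rewrite /pcomp /=; case: eqP.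
apply/pcompP; split=> //; rewrite px /pstart /pwalk /=.
by case: (val p).
Qed.

Lemma pcomp_eq_triv p q x :
  (pcomp p q == Some (ptriv x)) = (p == ptriv x) && (q == ptriv x).
Proof.
apply/eqP/andP => [/pcompP[qp]|[/eqP-> /eqP->]]; last first.
  by rewrite pcomp_trivl /= eqxx.
case=> xE /esym/eqP; rewrite -size_eq0 size_cat addn_eq0 !size_eq0.
case/andP=> /eqP q0 /eqP p0.
have qE : q = ptriv x.
  by apply: val_inj; rewrite [LHS]surjective_pairing -/(pstart q) -xE
    -/(pwalk q) q0.
split; last exact/eqP.
apply/eqP/val_inj; rewrite [LHS]surjective_pairing -/(pstart p) -qp
  -/(pwalk p) p0.
by rewrite qE.
Qed.

End Paths.

Section PathAlgebra.
Variables (k : fieldType) (Q : quiver).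

Definition path_algebra : Type := freemod k (qpath Q).
HB.instance Definition _ := GRing.Lmodule.on path_algebra.

Definition kpath (p : qpath Q) : path_algebra := fbasis k p.

(* The product of two paths that do not compose is zero. *)
Definition kpath_mul (p q : qpath Q) : path_algebra :=
  oapp kpath 0 (pcomp p q).

Definition pa_one : path_algebra := \sum_(x : Q) kpath (ptriv x).

Fact pa_mul_key : unit. Proof. exact: tt. Qed.
Definition pa_mul : path_algebra -> path_algebra -> path_algebra :=
  locked_with pa_mul_key (fun u v => flift (fun p => flift (kpath_mul p) v) u).

Lemma pa_mulE u v : pa_mul u v = flift (fun p => flift (kpath_mul p) v) u.
Proof. by rewrite [pa_mul]unlock. Qed.

Definition pa_rmul v u := pa_mul u v.

Lemma pa_mul_linearl v c a b :
  pa_mul (c *: a + b) v = c *: pa_mul a v + pa_mul b v.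
Proof. by rewrite !pa_mulE linearP. Qed.

Lemma pa_mul_linearr u c a b :
  pa_mul u (c *: a + b) = c *: pa_mul u a + pa_mul u b.
Proof.
rewrite !pa_mulE -flift_linear_fun; last first.
  by move=> e m; rewrite !scalerA mulrC.
by congr (flift _ u); apply/funext => p; rewrite linearP.
Qed.

Lemma pa_mul_kpath p q : pa_mul (kpath p) (kpath q) = kpath_mul p q.
Proof. by rewrite pa_mulE !flift_basis. Qed.

HB.instance Definition _ v := GRing.isLinear.Build k path_algebra path_algebra
  *:%R (pa_rmul v) (pa_mul_linearl v : linear (pa_rmul v)).
HB.instance Definition _ u := GRing.isLinear.Build k path_algebra path_algebra
  *:%R (pa_mul u) (pa_mul_linearr u).

Lemma pa_ind (P : path_algebra -> Prop) :
  P 0 -> (forall c p a, P a -> P (c *: kpath p + a)) -> forall a, P a.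
Proof. exact: freemod_ind. Qed.

Lemma pa_mul0 u : pa_mul u 0 = 0. Proof. exact: (raddf0 (pa_mul u)). Qed.
Lemma pa_0mul u : pa_mul 0 u = 0. Proof. exact: (raddf0 (pa_rmul u)). Qed.

Lemma pa_mulA : associative pa_mul.
Proof.
move=> u v w; elim/pa_ind: u => [|c p u IH]; first by rewrite !pa_0mul.
rewrite !pa_mul_linearl IH; congr (c *: _ + _).
elim/pa_ind: v {IH u} => [|d q v IH]; first by rewrite !(pa_mul0, pa_0mul).
rewrite pa_mul_linearl !pa_mul_linearr pa_mul_linearl IH.
congr (d *: _ + _).
elim/pa_ind: w {IH v} => [|e r w IH]; first by rewrite !pa_mul0.
rewrite !pa_mul_linearr IH; congr (e *: _ + _).
rewrite !pa_mul_kpath /kpath_mul; have := pcompA p q r.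
case: (pcomp q r) => [s|]; case: (pcomp p q) => [t|] /=;
  rewrite ?pa_mul0 ?pa_0mul ?pa_mul_kpath /kpath_mul.
- by move=> ->.
- by move=> ->.
- by move=> <-.
- by [].
Qed.

Lemma pa_suml (F : Q -> path_algebra) v :
  pa_mul (\sum_x F x) v = \sum_x pa_mul (F x) v.
Proof. exact: (raddf_sum (pa_rmul v)). Qed.
Lemma pa_sumr (F : Q -> path_algebra) u :
  pa_mul u (\sum_x F x) = \sum_x pa_mul u (F x).
Proof. exact: (raddf_sum (pa_mul u)). Qed.

Lemma pa_mul1 : left_id pa_one pa_mul.
Proof.
move=> u; elim/pa_ind: u => [|c p u IH]; first by rewrite pa_mul0.
rewrite pa_mul_linearr IH; congr (c *: _ + _).
rewrite /pa_one pa_suml (bigD1 (pend p)) //= big1 => [|x xp].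
  by rewrite addr0 pa_mul_kpath /kpath_mul pcomp_trivl eqxx.
by rewrite pa_mul_kpath /kpath_mul pcomp_trivl eq_sym (negbTE xp).
Qed.

Lemma pa_1mul : right_id pa_one pa_mul.
Proof.
move=> u; elim/pa_ind: u => [|c p u IH]; first by rewrite pa_0mul.
rewrite pa_mul_linearl IH; congr (c *: _ + _).
rewrite /pa_one pa_sumr (bigD1 (pstart p)) //= big1 => [|x xp].
  by rewrite addr0 pa_mul_kpath /kpath_mul pcomp_trivr eqxx.
by rewrite pa_mul_kpath /kpath_mul pcomp_trivr (negbTE xp).
Qed.

Lemma pa_mulDl : left_distributive pa_mul +%R.
Proof. by move=> u v w; exact: (raddfD (pa_rmul w)). Qed.
Lemma pa_mulDr : right_distributive pa_mul +%R.
Proof. by move=> u v w; exact: (raddfD (pa_mul u)). Qed.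

HB.instance Definition _ :=
  GRing.Zmodule_isPzRing.Build path_algebra pa_mulA pa_mul1 pa_1mul
    pa_mulDl pa_mulDr.

Lemma pa_coef0 p : (0 : path_algebra) p = 0. Proof. by []. Qed.
Lemma pa_coefD (u v : path_algebra) p : (u + v) p = u p + v p.
Proof. by []. Qed.
Lemma pa_coefB (u v : path_algebra) p : (u - v) p = u p - v p.
Proof. by []. Qed.
Lemma pa_coefZ c (u : path_algebra) p : (c *: u) p = c * u p.
Proof. by []. Qed.
Lemma pa_coef_kpath p q : kpath p q = (q == p)%:R. Proof. by []. Qed.

Lemma coef_ptriv_mul (u v : path_algebra) x :
  (u * v) (ptriv x) = u (ptriv x) * v (ptriv x).
Proof.
elim/pa_ind: u => [|c p u IH]; first by rewrite mul0r !pa_coef0 mul0r.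
rewrite [_ * v]pa_mul_linearl !pa_coefD !pa_coefZ [coef (pa_mul u v) _]IH.
rewrite mulrDl -mulrA; congr (c * _ + _).
elim/pa_ind: v {IH u} => [|d q v IH]; first by rewrite pa_mul0 !pa_coef0 mulr0.
rewrite pa_mul_linearr !pa_coefD !pa_coefZ IH mulrDr mulrCA; congr (d * _ + _).
rewrite pa_mul_kpath /kpath_mul !pa_coef_kpath -natrM mulnb.
rewrite ![ptriv x == _]eq_sym -pcomp_eq_triv.
by case: (pcomp p q) => [r|] //=; rewrite eq_sym.
Qed.

Definition arrow_ideal : ideal path_algebra :=
  gen_ideal [set u | exists a : arrow Q, u = kpath (parrow a)].

Record admissible_ideal := AdmissibleIdeal {
  adm_ideal :> ideal path_algebra;
  adm_bounds : exists2 m, (2 <= m)%N &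
    ideal_pow arrow_ideal m `<=` adm_ideal /\
    adm_ideal `<=` ideal_pow arrow_ideal 2 }.

Lemma arrow_ideal_coef u x : arrow_ideal u -> u (ptriv x) = 0.
Proof.
pose V (w : path_algebra) := w (ptriv x) = 0.
have V0 : V 0 by [].
have VB w z : V w -> V z -> V (w - z).
  by rewrite /V pa_coefB => -> ->; rewrite subrr.
have Vl w z : V z -> V (w * z) by rewrite /V coef_ptriv_mul => ->; rewrite mulr0.
have Vr w z : V z -> V (z * w) by rewrite /V coef_ptriv_mul => ->; rewrite mul0r.
move=> /(_ (Ideal V0 VB Vl Vr)); apply=> _ [a ->].
by rewrite /= /V pa_coef_kpath; case: eqP => // /(congr1 val).
Qed.

End PathAlgebra.

Section KernelModule.
Variables (R : pzRingType) (U V : lmodType R) (f : {linear U -> V}).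

Definition ker_pred : {pred U} := fun u => f u == 0.

Lemma ker_submod : submod_closed ker_pred.
Proof.
split=> [|c u v]; rewrite !unfold_in ?raddf0 // => /eqP fu /eqP fv.
by rewrite linearP fu fv scaler0 addr0.
Qed.

HB.instance Definition _ :=
  GRing.isSubmodClosed.Build R U ker_pred ker_submod.

Record kermod := KerMod { kerval : U; kervalP : kerval \in ker_pred }.

HB.instance Definition _ := [isSub for kerval].
HB.instance Definition _ := [Choice of kermod by <:].
HB.instance Definition _ := [SubChoice_isSubLmodule of kermod by <:].

Lemma kerval_is_linear : linear kerval. Proof. by []. Qed.
HB.instance Definition _ :=
  GRing.isLinear.Build R kermod U *:%R kerval kerval_is_linear.

End KernelModule.

Section Resolutions.
Variable R : pzRingType.

Definition projective (P : lmodType R) : Prop :=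
  forall (M N : lmodType R) (g : {linear M -> N}) (h : {linear P -> N}),
    (forall y, exists x, g x = y) ->
    exists l : {linear P -> M}, forall p, g (l p) = h p.

Record complex := Complex {
  cmod : nat -> lmodType R;
  cdiff : forall n, {linear cmod n.+1 -> cmod n} }.

Record projective_resolution (N : lmodType R) := ProjectiveResolution {
  pres : complex;
  paug : {linear cmod pres 0 -> N};
  pres_projective : forall n, projective (cmod pres n);
  paug_surj : forall y, exists x, paug x = y;
  pres_exact0 : forall x, paug x = 0 <-> exists y, cdiff pres 0 y = x;
  pres_exactS : forall n x,
    cdiff pres n x = 0 <-> exists y, cdiff pres n.+1 y = x }.

Definition proj_dim_le (N : lmodType R) (n : nat) : Prop :=
  exists P : projective_resolution N,
    forall m, (n < m)%N -> forall x : cmod (pres P) m, x = 0.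

(* Every left module is allowed, not only the finitely generated ones; being
   infinite means that no n bounds all the projective dimensions. *)
Definition infinite_gldim : Prop :=
  ~ exists n, forall N : lmodType R, proj_dim_le N n.

Lemma freemod_projective (X : choiceType) : projective (freemod R X).
Proof.
move=> M N g h gs.
pose l := flift (fun x => projT1 (cid (gs (h (fbasis R x))))).
exists l; apply: (@freemod_linear_ext _ _ _ (g \o l) h) => x /=.
by rewrite flift_basis; case: cid.
Qed.

(* The standard free resolution: P_n is free on the underlying set of the n-th
   syzygy, which maps onto that syzygy with kernel the next one. *)
Fixpoint syzygy (N : lmodType R) (n : nat) : lmodType R :=
  if n is n'.+1 then kermod (flift (@id (syzygy N n'))) else N.

Definition std_complex (N : lmodType R) : complex :=
  @Complex (fun n => freemod R (syzygy N n))
    (fun n => @kerval _ _ _ (flift (@id (syzygy N n)))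
                \o flift (@id (syzygy N n.+1))).

Lemma flift_id_surj (N : lmodType R) (y : N) : exists x, flift (@id N) x = y.
Proof. by exists (fbasis R y); rewrite flift_basis. Qed.

Lemma std_exact (N : lmodType R) n x :
  flift (@id (syzygy N n)) x = 0 <-> exists y, cdiff (std_complex N) n y = x.
Proof.
split=> [/eqP x0|[y <-]]; last first.
  exact/eqP/(kervalP (flift (@id (syzygy N n.+1)) y)).
have [y yE] := flift_id_surj (KerMod x0 : syzygy N n.+1).
by exists y; rewrite /= yE.
Qed.

Lemma std_exactS (N : lmodType R) n x :
  cdiff (std_complex N) n x = 0 <->
  exists y, cdiff (std_complex N) n.+1 y = x.
Proof.
rewrite -std_exact /=; split=> [x0|->]; last by rewrite raddf0.
by apply: val_inj; rewrite /= x0.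
Qed.

Definition std_resolution (N : lmodType R) : projective_resolution N :=
  @ProjectiveResolution N (std_complex N) (flift (@id N))
    (fun n => @freemod_projective (syzygy N n))
    (@flift_id_surj N) (@std_exact N 0) (@std_exactS N).

End Resolutions.

(* Right R-modules are left modules over the converse ring R^c: for m in
   M : lmodType R^c and a in R, the element m a is (a : R^c) *: m. *)
Section TensorProduct.
Variables (R : pzRingType) (M : lmodType R^c) (N : lmodType R).

Local Notation e m n := (fbasis int (m, n) : freemod int (M * N)%type).

Definition tensor_relations : set (freemod int (M * N)%type) :=
  [set z | (exists m m' n, z = e (m + m') n - e m n - e m' n)
        \/ (exists m n n', z = e m (n + n') - e m n - e m n')
        \/ (exists m (a : R) n, z = e ((a : R^c) *: m) n - e m (a *: n))].

Definition tensor : Type := Quotient.quot (addspan_pred tensor_relations).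
HB.instance Definition _ := GRing.Zmodule.on tensor.

Definition tproj (z : freemod int (M * N)%type) : tensor :=
  \pi_(Quotient.quot (addspan_pred tensor_relations)) z.
Definition trepr (t : tensor) : freemod int (M * N)%type :=
  repr (t : Quotient.quot (addspan_pred tensor_relations)).

Definition tens (m : M) (n : N) : tensor := tproj (e m n).

Lemma treprK t : tproj (trepr t) = t. Proof. exact: reprK. Qed.

Lemma tproj_eqP z z' : tproj z = tproj z' <-> addspan tensor_relations (z - z').
Proof.
split; first by move/eqP; rewrite -Quotient.idealrBE => /addspan_predP.
by move=> /addspan_predP h; apply/eqP; rewrite -Quotient.idealrBE.
Qed.

Lemma tproj_is_zmod_morphism : zmod_morphism tproj.
Proof.
exact: (raddfB \pi_(Quotient.quot (addspan_pred tensor_relations))).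
Qed.
HB.instance Definition _ := GRing.isZmodMorphism.Build
  (freemod int (M * N)%type) tensor tproj tproj_is_zmod_morphism.

Lemma tensDl m m' n : tens (m + m') n = tens m n + tens m' n.
Proof.
rewrite /tens -raddfD; apply/tproj_eqP; rewrite opprD addrA.
by apply: sub_addspan; left; exists m, m', n.
Qed.

Lemma tensDr m n n' : tens m (n + n') = tens m n + tens m n'.
Proof.
rewrite /tens -raddfD; apply/tproj_eqP; rewrite opprD addrA.
by apply: sub_addspan; right; left; exists m, n, n'.
Qed.

Lemma tensZ m (a : R) n : tens ((a : R^c) *: m) n = tens m (a *: n).
Proof.
apply/tproj_eqP; apply: sub_addspan; right; right.
by exists m, a, n.
Qed.

End TensorProduct.

Section TensorMap.
Variables (R : pzRingType) (M : lmodType R^c) (N N' : lmodType R).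
Variable f : {linear N -> N'}.

Definition tensor_gen (x : M * N) : zmodule (tensor M N') := tens x.1 (f x.2).

Definition tensor_premap (z : freemod int (M * N)%type) : tensor M N' :=
  flift tensor_gen z.

Lemma tensor_premapB z z' :
  tensor_premap (z - z') = tensor_premap z - tensor_premap z'.
Proof. exact: (raddfB (flift tensor_gen)). Qed.

Lemma tensor_premap_basis m n :
  tensor_premap (fbasis int (m, n)) = tens m (f n).
Proof. exact: (flift_basis tensor_gen). Qed.

Lemma tensor_premap0 z :
  addspan (@tensor_relations R M N) z -> tensor_premap z = 0.
Proof.
move=> /(_ [set y | tensor_premap y = 0]); apply.
- exact: (raddf0 (flift tensor_gen)).
- by move=> u v /= u0 v0; rewrite tensor_premapB u0 v0 subrr.
- move=> {}z; case=> [[m [m' [n ->]]]|[[m [n [n' ->]]]|[m [a [n ->]]]]];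
    rewrite /= !tensor_premapB !tensor_premap_basis.
  + by rewrite tensDl addrAC addrK subrr.
  + by rewrite raddfD tensDr addrAC addrK subrr.
  + by rewrite linearZ tensZ subrr.
Qed.

Definition tensor_map (t : tensor M N) : tensor M N' := tensor_premap (trepr t).

Lemma tensor_map_proj z : tensor_map (tproj z) = tensor_premap z.
Proof.
apply/eqP; rewrite -subr_eq0 -tensor_premapB; apply/eqP/tensor_premap0.
by apply/tproj_eqP; rewrite treprK.
Qed.

Lemma tensor_map_tens m n : tensor_map (tens m n) = tens m (f n).
Proof. by rewrite tensor_map_proj tensor_premap_basis. Qed.

Lemma tensor_map_is_zmod_morphism : zmod_morphism tensor_map.
Proof.
move=> t u; rewrite -[t]treprK -[u]treprK -raddfB !tensor_map_proj.
exact: tensor_premapB.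
Qed.

HB.instance Definition _ := GRing.isZmodMorphism.Build
  (tensor M N) (tensor M N') tensor_map tensor_map_is_zmod_morphism.

End TensorMap.
Arguments tensor_map {R} M {N N'} f t.

Section Homology.
Variables (A B C : zmodType) (f : {additive A -> B}) (g : {additive B -> C}).

Definition cycle_pred : {pred B} := fun x => g x == 0.

Lemma cycle_zmod : zmod_closed cycle_pred.
Proof.
split=> [|x y]; rewrite !unfold_in ?raddf0 // => /eqP gx /eqP gy.
by rewrite raddfB gx gy subrr.
Qed.

HB.instance Definition _ := GRing.isZmodClosed.Build B cycle_pred cycle_zmod.

Record cycles := Cycle { cycle_val : B; cycle_valP : cycle_val \in cycle_pred }.

HB.instance Definition _ := [isSub for cycle_val].
HB.instance Definition _ := [Choice of cycles by <:].
HB.instance Definition _ := [SubChoice_isSubZmodule of cycles by <:].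

Definition boundary_pred : {pred cycles} :=
  fun z => `[< exists a, f a = cycle_val z >].

Lemma boundary_zmod : zmod_closed boundary_pred.
Proof.
split=> [|x y /asboolP[a ax] /asboolP[b bY]]; apply/asboolP.
  by exists 0; rewrite raddf0.
by exists (a - b); rewrite raddfB ax bY.
Qed.

HB.instance Definition _ :=
  GRing.isZmodClosed.Build cycles boundary_pred boundary_zmod.

Definition homology : zmodType := Quotient.quot boundary_pred.

End Homology.

Section Tor.
Variables (R : pzRingType) (M : lmodType R^c).

(* Degree n homology of the complex M (x) P, which is zero in negative degrees. *)
Definition tensor_homology (P : complex R) (n : nat) : zmodType :=
  match n with
  | 0 => homology (tensor_map M (cdiff P 0))
           (\0 : {additive tensor M (cmod P 0) -> tensor M (cmod P 0)})
  | n'.+1 => homology (tensor_map M (cdiff P n'.+1))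
               (tensor_map M (cdiff P n'))
  end.

Definition Tor (N : lmodType R) (n : nat) : zmodType :=
  tensor_homology (pres (std_resolution N)) n.

End Tor.

Definition graded_infinite (V : nat -> zmodType) : Prop :=
  infinite_set [set n | exists v : V n, v != 0].

Definition simple_left (k : fieldType) (Q : quiver) (I : admissible_ideal k Q)
  (x : Q) : Type := k.
Definition simple_right (k : fieldType) (Q : quiver) (I : admissible_ideal k Q)
  (x : Q) : Type := k.

Section BoundQuiverAlgebra.
Variables (k : fieldType) (Q : quiver) (I : admissible_ideal k Q).

Definition bqa : pzRingType := quotring I.

Definition videm (x : Q) : bqa := qproj I (kpath k (ptriv x)).

(* y Lambda x <> 0, where y Lambda x is spanned by the paths from x to y. *)
Definition corner_nonzero (y x : Q) : Prop :=
  exists a : bqa, videm y * a * videm x != 0.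

Lemma adm_ideal_coef (u : path_algebra k Q) x : I u -> u (ptriv x) = 0.
Proof.
have [m _ [_ IF]] := adm_bounds I.
move=> /IF uF; apply: arrow_ideal_coef; apply: uF => [||_ [a [b [aF _ ->]]]].
- exact: ideal0.
- exact: idealB.
- exact: idealMr.
Qed.

(* The coefficient of the trivial path at x, as a function on kQ/I. *)
Definition vaug (x : Q) (a : bqa) : k := qrepr a (ptriv x).

Lemma vaug_proj x u : vaug x (qproj I u) = u (ptriv x).
Proof.
apply/eqP; rewrite -subr_eq0 -pa_coefB; apply/eqP/adm_ideal_coef/qreprP.
Qed.

Lemma vaugM x a b : vaug x (a * b) = vaug x a * vaug x b.
Proof.
by rewrite -[a]qreprK -[b]qreprK -rmorphM !vaug_proj coef_ptriv_mul.
Qed.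

Lemma vaugD x a b : vaug x (a + b) = vaug x a + vaug x b.
Proof. by rewrite -[a]qreprK -[b]qreprK -raddfD !vaug_proj pa_coefD. Qed.

Lemma vaug1 x : vaug x 1 = 1.
Proof.
rewrite -(rmorph1 (qproj I)) vaug_proj.
have := coef_ptriv_mul 1 (kpath k (ptriv x)) x.
by rewrite mul1r pa_coef_kpath eqxx mulr1 => <-.
Qed.

Section Simples.
Variable x : Q.

HB.instance Definition _ := GRing.Zmodule.copy (simple_left I x) k.
HB.instance Definition _ := GRing.Zmodule.copy (simple_right I x) k.

(* a in kQ/I acts on the one-dimensional simple module at x by the coefficient
   of the trivial path at x. *)
Definition sl_scale (a : bqa) (c : simple_left I x) : simple_left I x :=
  vaug x a * (c : k).
Definition sr_scale (a : bqa^c) (c : simple_right I x) : simple_right I x :=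
  (c : k) * vaug x a.

Fact sl_scaleA a b c : sl_scale a (sl_scale b c) = sl_scale (a * b) c.
Proof. by rewrite /sl_scale vaugM mulrA. Qed.
Fact sl_scale1 : left_id 1 sl_scale.
Proof. by move=> c; rewrite /sl_scale vaug1 mul1r. Qed.
Fact sl_scaleDr : right_distributive sl_scale +%R.
Proof. by move=> a c d; apply: (mulrDr (vaug x a) (c : k)). Qed.
Fact sl_scaleDl c : {morph sl_scale^~ c : a b / a + b}.
Proof. by move=> a b; rewrite /sl_scale vaugD; apply: mulrDl. Qed.

HB.instance Definition _ := GRing.Zmodule_isLmodule.Build bqa (simple_left I x)
  sl_scaleA sl_scale1 sl_scaleDr sl_scaleDl.

Fact sr_scaleA a b c : sr_scale a (sr_scale b c) = sr_scale (a * b) c.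
Proof. by rewrite /sr_scale [a * b]/(_ * _ : bqa) vaugM mulrA. Qed.
Fact sr_scale1 : left_id 1 sr_scale.
Proof. by move=> c; rewrite /sr_scale vaug1 mulr1. Qed.
Fact sr_scaleDr : right_distributive sr_scale +%R.
Proof. by move=> a c d; apply: mulrDl. Qed.
Fact sr_scaleDl c : {morph sr_scale^~ c : a b / a + b}.
Proof. by move=> a b; rewrite /sr_scale vaugD; apply: mulrDr. Qed.

HB.instance Definition _ := GRing.Zmodule_isLmodule.Build bqa^c
  (simple_right I x) sr_scaleA sr_scale1 sr_scaleDr sr_scaleDl.

End Simples.

Definition infinite_plus_gldim : Prop :=
  exists y x : Q, corner_nonzero y x /\
    graded_infinite (Tor (simple_right I x) (simple_left I y)).

Definition infinite_coplus_gldim : Prop :=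
  exists y x : Q, corner_nonzero y x /\
    graded_infinite (Tor (simple_right I y) (simple_left I x)).

End BoundQuiverAlgebra.

(* Main.v *)
Require Import Defs.
From HB Require Import structures.
From mathcomp Require Import all_boot all_order all_algebra.
From mathcomp Require Import generic_quotient ring_quotient.
From mathcomp Require Import boolp classical_sets functions cardinality fsbigop.

Set Implicit Arguments.
Unset Strict Implicit.
Unset Printing Implicit Defensive.

Import GRing.Theory.
Local Open Scope classical_set_scope.
Local Open Scope ring_scope.
Local Open Scope quotient_scope.

(**
  All the content lies in [infinite_Tor]: when the global dimension is infinite,
  Tor_*(k_x, _yk) is infinite for some pair of vertices x, y.  Given such a
  pair, each hypothesis on corners supplies the nonzero corner that the
  conclusion asks for.

  The contrapositive of [infinite_Tor] is proved.  Let J be the radical of the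
  algebra Lambda; it is nilpotent, and Lambda / J is a product of copies of k
  indexed by the vertices.  Suppose that Tor_n(k_x, _yk) = 0 for all x, y and
  all n > N.

  First, the N-th syzygy of each simple left module is projective.  The
  vanishing of Tor_(N+1) says that the next syzygy K, a submodule of a free
  module F, satisfies K /\ J F = J K ([thin_of_Tor]).  Any map from such a K to
  a module X then extends to F: by Zorn's lemma K has a complement modulo J F,
  which settles the case J X = 0, and the general case follows by induction on
  the nilpotence degree of X ([extend_nilpotent]).  Extending the identity of K
  splits K off F ([projective_of_thin_kernel]).

  Secondly, a bound N on the projective dimensions of the simple modules bounds
  that of every module ([pd_le_all]).  Modules of projective dimension at most N
  are closed under extensions ([pd_le_ext]) and under arbitrary direct sums
  ([pd_le_dsum]).  A module killed by J is a finite extension of direct sums of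
  copies of a simple, by choice of a basis at each vertex ([isotypic_basis],
  [pd_le_semisimple]); an arbitrary module is a finite extension of modules
  killed by J, as J is nilpotent.  Infinite direct sums enter because the global
  dimension is taken over all modules.
*)

(** * Projective dimension *)

Definition linear_of (R : pzRingType) (M N : lmodType R) (f : M -> N)
    (fl : linear f) : {linear M -> N} :=
  HB.pack f (GRing.isLinear.Build R M N *:%R f fl).

Section ProjectiveDimension.
Variable R : pzRingType.
Implicit Types L M N P : lmodType R.

Lemma projective_retract P M (s : {linear M -> P}) (r : {linear P -> M}) :
  cancel s r -> projective P -> projective M.
Proof.
move=> sK Pproj A B g h gs; have [l lE] := Pproj A B g (h \o r) gs.
by exists (l \o s) => m /=; rewrite lE /= sK.
Qed.

Lemma projective_prod P P' :
  projective P -> projective P' -> projective (P * P')%type.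
Proof.
move=> pP pP' A B g h gs.
have h1l : linear (fun p : P => h (p, 0)).
  move=> c u v; rewrite -linearP; congr (h _).
  by apply/pair_equal_spec; split=> //=; rewrite scaler0 addr0.
have h2l : linear (fun p : P' => h (0, p)).
  move=> c u v; rewrite -linearP; congr (h _).
  by apply/pair_equal_spec; split=> //=; rewrite scaler0 addr0.
have [l1 l1E] := pP A B g (linear_of h1l) gs.
have [l2 l2E] := pP' A B g (linear_of h2l) gs.
have ll : linear (fun p : P * P' => l1 p.1 + l2 p.2).
  by move=> c [u u'] [v v'] /=; rewrite !linearP scalerDr addrACA.
exists (linear_of ll) => -[p p'] /=.
rewrite raddfD /= l1E l2E /= -raddfD; congr (h _).
by apply/pair_equal_spec; split=> /=; rewrite ?addr0 ?add0r.
Qed.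

Lemma projective_trivial P : (forall x : P, x = 0) -> projective P.
Proof.
move=> P0 A B g h gs; exists (\0 : {linear P -> A}) => p.
by rewrite (P0 p) !raddf0.
Qed.

Lemma projective_section P M (g : {linear M -> P}) :
  projective P -> (forall y, exists x, g x = y) ->
  exists s : {linear P -> M}, cancel s g.
Proof. by move=> pP /(pP _ _ g idfun). Qed.

Lemma kermodP M N (f : {linear M -> N}) (x : kermod f) : f (kerval x) = 0.
Proof. exact/eqP/(kervalP x). Qed.

Lemma kermod_lift M N (f : {linear M -> N}) (x : M) :
  f x = 0 -> exists y : kermod f, kerval y = x.
Proof. by move=> /eqP fx; exists (KerMod fx). Qed.

Lemma kerval_inj M N (f : {linear M -> N}) : injective (@kerval _ _ _ f).
Proof. exact: val_inj. Qed.

Lemma kermod_corestr M N L (f : {linear M -> N}) (h : {linear L -> M}) :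
  (forall x, f (h x) = 0) ->
  exists h' : {linear L -> kermod f}, forall x, kerval (h' x) = h x.
Proof.
move=> fh; pose h' x : kermod f := KerMod (introT eqP (fh x)).
have h'l : linear h' by move=> c u v; apply: val_inj; rewrite /= linearP.
by exists (linear_of h'l).
Qed.

(** Peeling off one projective surjection at a time makes the closure properties
    below plain inductions: the projective resolutions they need never have to
    be compared with a fixed one. *)
Fixpoint pd_le (n : nat) M : Prop :=
  if n is n'.+1 then
    exists P (g : {linear P -> M}),
      [/\ projective P, forall y, exists x, g x = y & pd_le n' (kermod g)]
  else projective M.

Section Cons.
Variables (M P : lmodType R) (g : {linear P -> M}) (C : complex R).
Variable (d : {linear cmod C 0 -> P}).

Definition cons_mod (n : nat) : lmodType R :=
  if n is n'.+1 then cmod C n' else P.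
Definition cons_diff (n : nat) : {linear cons_mod n.+1 -> cons_mod n} :=
  if n is n'.+1 return {linear cons_mod n.+1 -> cons_mod n}
  then cdiff C n' else d.
Definition cons_complex : complex R := Complex cons_diff.
End Cons.

(** Splicing: a resolution of the kernel of g, preceded by P.  It is left
    transparent because its terms in high degrees have to be recognised. *)
Lemma cons_resolution M P (g : {linear P -> M}) :
  projective P -> (forall y, exists x, g x = y) ->
  forall C : projective_resolution (kermod g),
  projective_resolution M.
Proof.
move=> pP gs C.
pose d : {linear cmod (pres C) 0 -> P} := @kerval _ _ _ g \o paug C.
apply: (@ProjectiveResolution R M (cons_complex d) g) => //.
- by case=> [|n] //=; apply: pres_projective.
- move=> x; split=> [/kermod_lift[y <-]|[y <-]]; last exact: kermodP.
  by have [z <-] := paug_surj C y; exists z.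
- case=> [|n] x /=; last exact: pres_exactS.
  rewrite -pres_exact0 /=; split=> [x0|->]; last exact: raddf0.
  by apply: kerval_inj; rewrite x0.
Defined.

Definition trivial_complex : complex R :=
  @Complex R (fun=> freemod R void) (fun=> \0).

Lemma freemod_void (x : freemod R void) : x = 0.
Proof. by apply: freemodP => -[]. Qed.

Lemma trivial_resolution M : (forall x : M, x = 0) -> projective_resolution M.
Proof.
move=> M0.
apply: (@ProjectiveResolution R M trivial_complex \0) => //.
- by move=> n; apply: freemod_projective.
- by move=> y; exists 0; rewrite (M0 y).
- by move=> x; split=> // _; exists 0; rewrite (freemod_void x).
- by move=> n x; split=> // _; exists 0; rewrite (freemod_void x).
Defined.

Lemma pd_le_proj_dim n M : pd_le n M -> proj_dim_le M n.
Proof.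
elim: n M => [|n IH] M /=.
  move=> pM.
  have K0 (x : kermod (idfun : {linear M -> M})) : x = 0.
    by apply: kerval_inj; apply: (kermodP x).
  have ids (y : M) : exists x, (idfun : {linear M -> M}) x = y by exists y.
  exists (cons_resolution pM ids (trivial_resolution K0)).
  by case=> // m _ /= x; apply: freemod_void.
move=> [P [g [pP gs /IH[C C0]]]].
by exists (cons_resolution pP gs C); case=> // m ltnm; apply: C0.
Qed.

(** The horseshoe construction: projectives over M' and M'' add up to one over
    M, and its kernel is again an extension of the two kernels, so the induction
    goes through. *)
Lemma pd_le_ext n M' M M'' (f : {linear M' -> M}) (g : {linear M -> M''}) :
  injective f -> (forall y, exists x, g x = y) ->
  (forall x, g x = 0 <-> exists y, f y = x) ->
  pd_le n M' -> pd_le n M'' -> pd_le n M.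
Proof.
elim: n M' M M'' f g => [|n IH] M' M M'' f g fi gs ex /=.
  move=> pM' pM''; have [s sK] := projective_section pM'' gs.
  have al : linear (fun p : M' * M'' => f p.1 + s p.2).
    by move=> c u v /=; rewrite !linearP scalerDr addrACA.
  have as_ y : exists x, linear_of al x = y.
    have [|z zE] := (ex (y - s (g y))).1; first by rewrite raddfB /= sK subrr.
    by exists (z, g y); rewrite /= zE subrK.
  have ai : injective (linear_of al).
    apply: raddf_inj => -[u v] /= /eqP; rewrite addr_eq0 => /eqP fu.
    have v0 : v = 0.
      apply: oppr_inj; rewrite oppr0 -[LHS]sK raddfN -fu.
      by apply/ex; exists u.
    by rewrite v0 (fi u 0) // fu v0 !raddf0.
  pose b y := sval (cid (as_ y)).
  have bK y : f (b y).1 + s (b y).2 = y by rewrite /b; case: cid.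
  have bl : linear b.
    move=> c u v; apply: ai; rewrite [RHS]linearP /= !bK.
    by [].
  apply: (projective_retract (s := linear_of bl) (r := linear_of al)).
    by move=> y /=; rewrite bK.
  exact: projective_prod.
move=> [P' [g' [pP' gs' pd']]] [P'' [g'' [pP'' gs'' pd'']]].
have [l lE] := pP'' _ _ g g'' gs.
have al : linear (fun p : P' * P'' => f (g' p.1) + l p.2).
  by move=> c u v /=; rewrite !linearP scalerDr addrACA.
have gf u : g (f u) = 0 by apply/ex; exists u.
exists (P' * P'')%type, (linear_of al); split.
- exact: projective_prod.
- move=> y; have [p'' p''E] := gs'' (g y).
  have [|z zE] := (ex (y - l p'')).1; first by rewrite raddfB /= lE p''E subrr.
  have [p' p'E] := gs' z; exists (p', p'').
  by rewrite /= p'E zE subrK.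
have il : linear (fun p : P' => (p, 0 : P'')).
  by move=> c u v; apply/pair_equal_spec; split=> //=; rewrite scaler0 addr0.
have [i iE] : exists i : {linear kermod g' -> kermod (linear_of al)},
    forall x, kerval (i x) = (kerval x, 0).
  apply: (kermod_corestr (h := linear_of il \o @kerval _ _ _ g')) => x /=.
  by rewrite kermodP !raddf0 add0r.
have snl : linear (fun p : P' * P'' => p.2) by [].
have [q qE] : exists q : {linear kermod (linear_of al) -> kermod g''},
    forall x, kerval (q x) = (kerval x).2.
  apply: (kermod_corestr (h := linear_of snl \o @kerval _ _ _ _)) => x /=.
  have /= /(congr1 g) := kermodP x.
  by rewrite raddfD /= gf add0r lE raddf0.
apply: (IH _ _ _ i q) pd' pd'' => [||x].
- move=> u v /(congr1 (@kerval _ _ _ (linear_of al))).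
  by rewrite !iE => -[/kerval_inj].
- move=> y; have [|z zE] := (ex (l (kerval y))).1.
    by rewrite lE kermodP.
  have [p' p'E] := gs' (- z).
  have [|x xE] := kermod_lift (f := linear_of al) (x := (p', kerval y)).
    by rewrite /= p'E linearN -zE addNr.
  by exists x; apply: kerval_inj; rewrite qE xE.
- split=> [x0|[y <-]]; last by apply: kerval_inj; rewrite qE iE raddf0.
  have x2 : (kerval x).2 = 0 by rewrite -qE x0 raddf0.
  have /= := kermodP x; rewrite x2 raddf0 addr0 -[0](raddf0 f) => /fi.
  move=> /kermod_lift[y yE]; exists y; apply: kerval_inj.
  by rewrite iE yE -x2; case: (kerval x).
Qed.

Lemma pd_le_trivial n M : (forall x : M, x = 0) -> pd_le n M.
Proof.
elim: n M => [|n IH] M M0 /=; first exact: projective_trivial.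
exists M, idfun; split; [exact: projective_trivial | by move=> y; exists y |].
by apply: IH => x; apply: kerval_inj; apply: M0.
Qed.

Lemma pd_le_iso n M M' (f : {linear M' -> M}) :
  injective f -> (forall y, exists x, f x = y) -> pd_le n M' -> pd_le n M.
Proof.
move=> fi fs pd'.
have K0 (x : freemod R void) : x = 0 by exact: freemod_void.
apply: (@pd_le_ext n M' M (freemod R void) f \0) => //.
- by move=> y; exists 0; rewrite (K0 y).
- exact: pd_le_trivial.
Qed.

(** The standard syzygies are built from the inside outwards, while [pd_le]
    peels from the outside; hence the induction on the number of syzygies
    already taken. *)
Lemma pd_le_syzygy n M : projective (syzygy M n) -> pd_le n M.
Proof.
suff H m i : pd_le m (syzygy M i) -> pd_le (m + i) M.
  by rewrite -[n]add0n => ?; apply: H.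
elim: i m => [|i IH] m; first by rewrite addn0.
move=> pd; rewrite addnS -addSn; apply: IH => /=.
exists (freemod R (syzygy M i)), (flift (@id (syzygy M i))); split=> //.
  exact: freemod_projective.
exact: flift_id_surj.
Qed.

End ProjectiveDimension.

(** * Direct sums and quotient modules *)

Section DirectSum.
Variables (R : pzRingType) (M : lmodType R) (X : choiceType) (B : set X).

(** The support is confined to a variable subset B of a fixed index type, so
    that direct sums over different index sets can be compared without changing
    types: the search for a basis below varies B. *)
Definition dsum_pred : {pred X -> M} :=
  fun a => `[< finite_set [set x | a x != 0] /\ [set x | a x != 0] `<=` B >].

Lemma dsum_submod : submod_closed dsum_pred.
Proof.
split.
  apply/asboolP; split=> [|x /=]; last by rewrite eqxx.
  by apply: sub_finite_set (finite_set0 X) => x /=; rewrite eqxx.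
move=> c a b /asboolP[fa aB] /asboolP[fb bB]; apply/asboolP.
have sub : [set x | (c *: a + b) x != 0]
    `<=` [set x | a x != 0] `|` [set x | b x != 0].
  move=> x /= nz; have [a0|] := eqVneq (a x) 0; last by left.
  have [b0|] := eqVneq (b x) 0; last by right.
  by case/eqP: nz; rewrite -[LHS]/(c *: a x + b x) a0 b0 scaler0 addr0.
split; first by apply: sub_finite_set sub _; rewrite finite_setU.
by move=> x /sub[/aB|/bB].
Qed.

HB.instance Definition _ :=
  GRing.isSubmodClosed.Build R (X -> M) dsum_pred dsum_submod.

Record dsum := Dsum { dval : X -> M; dvalP : dval \in dsum_pred }.

HB.instance Definition _ := [isSub for dval].
HB.instance Definition _ := [Choice of dsum by <:].
HB.instance Definition _ := [SubChoice_isSubLmodule of dsum by <:].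

Lemma dvalD (a b : dsum) x : dval (a + b) x = dval a x + dval b x.
Proof. by []. Qed.
Lemma dvalZ c (a : dsum) x : dval (c *: a) x = c *: dval a x.
Proof. by []. Qed.
Lemma dval0 x : dval 0 x = 0. Proof. by []. Qed.
Lemma dvalB (a b : dsum) x : dval (a - b) x = dval a x - dval b x.
Proof. by []. Qed.

Lemma dsumP (a b : dsum) : (forall x, dval a x = dval b x) -> a = b.
Proof. by move=> ab; apply: val_inj; apply/funext. Qed.

Lemma dsum_support (a : dsum) x : dval a x != 0 -> B x.
Proof. by have /asboolP[_ aB] := dvalP a; apply: aB. Qed.

Lemma dsum_seq (a : dsum) :
  exists2 s : seq X, uniq s & forall x, dval a x != 0 -> x \in s.
Proof.
have /asboolP[/finite_seqP[s sE] _] := dvalP a.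
exists (undup s); first exact: undup_uniq.
move=> x ax; rewrite mem_undup.
by have : [set x | dval a x != 0] x by []; rewrite sE.
Qed.

Fact dsum_in_subproof x m :
  (fun y => if (y == x) && `[< B x >] then m else 0) \in dsum_pred.
Proof.
apply/asboolP; split.
  apply: sub_finite_set (finite_set1 x) => y /=.
  by case: (eqVneq y x) => //=; rewrite eqxx.
move=> y /=; case: (eqVneq y x) => [->|] /=; last by rewrite eqxx.
by case: asboolP => //; rewrite eqxx.
Qed.

Definition dsum_in x (m : M) : dsum := Dsum (dsum_in_subproof x m).

Lemma dsum_inE x m y :
  dval (dsum_in x m) y = if (y == x) && `[< B x >] then m else 0.
Proof. by []. Qed.

Lemma dsum_in_linear x : linear (dsum_in x).
Proof.
move=> c u v; apply: dsumP => y; rewrite dvalD dvalZ !dsum_inE.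
by case: ifP => //; rewrite scaler0 addr0.
Qed.

HB.instance Definition _ x :=
  GRing.isLinear.Build R M dsum *:%R (dsum_in x) (dsum_in_linear x).

Lemma dsum_ind (P : dsum -> Prop) :
  P 0 -> (forall x m a, B x -> P a -> P (dsum_in x m + a)) -> forall a, P a.
Proof.
move=> P0 PS a; have [s _] := dsum_seq a.
elim: s a => [|x s IH] a sP.
  suff -> : a = 0 by [].
  apply: dsumP => x; apply/eqP; rewrite dval0.
  by apply: contraT => /sP.
have [a0|ax] := eqVneq (dval a x) 0.
  apply: IH => y ay; have := sP y ay; rewrite inE; case/predU1P => // yx.
  by rewrite yx a0 eqxx in ay.
have -> : a = dsum_in x (dval a x) + (a - dsum_in x (dval a x)).
  by rewrite addrC subrK.
have Bx := dsum_support ax.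
apply: PS => //; apply: IH => y; rewrite dvalB dsum_inE (asboolT Bx) andbT.
case: (eqVneq y x) => [->|yx]; first by rewrite subrr eqxx.
by rewrite subr0 => /sP; rewrite inE (negbTE yx).
Qed.

Section Lift.
Variables (N : lmodType R) (F : X -> {linear M -> N}).

Definition dlift (a : dsum) : N := \sum_(x \in [set: X]) F x (dval a x).

Lemma dliftE (s : seq X) (a : dsum) :
  uniq s -> (forall x, dval a x != 0 -> x \in s) ->
  dlift a = \sum_(x <- s) F x (dval a x).
Proof.
move=> us sP; rewrite /dlift (fsbigE s) //.
  by apply: eq_bigl => x; rewrite in_setT.
by move=> x _; have [->|/sP ->//] := eqVneq (dval a x) 0; rewrite raddf0.
Qed.

Lemma dlift_is_linear : linear dlift.
Proof.
move=> c a b; have [s us sP] := dsum_seq a; have [t ut tP] := dsum_seq b.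
pose r := undup (s ++ t).
have ur : uniq r by apply: undup_uniq.
have rs x : x \in s -> x \in r by rewrite mem_undup mem_cat => ->.
have rt x : x \in t -> x \in r by rewrite mem_undup mem_cat orbC => ->.
have abP x : dval (c *: a + b) x != 0 -> x \in r.
  rewrite dvalD dvalZ; have [->|/sP/rs//] := eqVneq (dval a x) 0.
  by rewrite scaler0 add0r => /tP/rt.
rewrite (dliftE ur abP) (dliftE ur (fun x ax => rs x (sP x ax))).
rewrite (dliftE ur (fun x bx => rt x (tP x bx))).
rewrite scaler_sumr -big_split; apply: eq_bigr => x _.
by rewrite dvalD dvalZ linearP.
Qed.

HB.instance Definition _ :=
  GRing.isLinear.Build R dsum N *:%R dlift dlift_is_linear.

Lemma dlift_in x m : B x -> dlift (dsum_in x m) = F x m.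
Proof.
move=> Bx; rewrite (@dliftE [:: x]) // => [|y].
  by rewrite big_seq1 dsum_inE eqxx asboolT.
by rewrite dsum_inE inE; case: (y == x) => //=; rewrite eqxx.
Qed.

End Lift.

Lemma dsum_projective : projective M -> projective dsum.
Proof.
move=> pM A N g h gs.
pose l x := sval (cid (pM A N g (h \o dsum_in x) gs)).
have lE x m : g (l x m) = h (dsum_in x m) by rewrite /l; case: cid => /=.
exists (dlift l); elim/dsum_ind => [|x m a Bx IH]; first by rewrite !raddf0.
by rewrite !raddfD /= IH dlift_in // lE.
Qed.

End DirectSum.

Lemma dsum_change (R : pzRingType) (M : lmodType R) (X : choiceType)
    (B B' : set X) (a : dsum M B) :
  (forall x, dval a x != 0 -> B' x) ->
  exists a' : dsum M B', dval a' = dval a.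
Proof.
move=> aB'; have aP : dval a \in dsum_pred (M := M) B'.
  by have /asboolP[fa _] := dvalP a; apply/asboolP; split.
by exists (Dsum aP).
Qed.

Lemma dlift_change (R : pzRingType) (M N : lmodType R) (X : choiceType)
    (B B' : set X) (F : X -> {linear M -> N}) (a : dsum M B) (a' : dsum M B') :
  dval a' = dval a -> dlift F a' = dlift F a.
Proof. by rewrite /dlift => ->. Qed.

Section DirectSumMap.
Variables (R : pzRingType) (M N : lmodType R) (X : choiceType) (B : set X).
Variable f : {linear M -> N}.

Fact dsum_map_subproof (a : dsum M B) : (f \o dval a) \in dsum_pred (M := N) B.
Proof.
have /asboolP[fa aB] := dvalP a.
have sub : [set x | (f \o dval a) x != 0] `<=` [set x | dval a x != 0].
  by move=> x /=; apply: contra_neq => ->; rewrite raddf0.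
apply/asboolP; split; first exact: sub_finite_set sub fa.
by move=> x /sub /aB.
Qed.

Definition dsum_map (a : dsum M B) : dsum N B := Dsum (dsum_map_subproof a).

Lemma dsum_mapE a x : dval (dsum_map a) x = f (dval a x). Proof. by []. Qed.

Lemma dsum_map_linear : linear dsum_map.
Proof.
by move=> c a b; apply: dsumP => x; rewrite dsum_mapE !dvalD !dvalZ linearP.
Qed.

HB.instance Definition _ :=
  GRing.isLinear.Build R (dsum M B) (dsum N B) *:%R dsum_map dsum_map_linear.

Lemma dsum_map_in x m : dsum_map (dsum_in B x m) = dsum_in B x (f m).
Proof.
apply: dsumP => y; rewrite dsum_mapE !dsum_inE.
by case: ifP => //; rewrite raddf0.
Qed.

Lemma dsum_map_surj :
  (forall y, exists x, f x = y) -> forall b, exists a, dsum_map a = b.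
Proof.
move=> fs; elim/dsum_ind => [|x n b _ [a <-]].
  by exists 0; rewrite raddf0.
have [m <-] := fs n; exists (dsum_in B x m + a).
by rewrite raddfD /= dsum_map_in.
Qed.

End DirectSumMap.
Arguments dsum_map {R M N X} B f.

(** A direct sum of projectives is projective, and the kernel of a direct sum
    of copies of g is the direct sum of copies of its kernel. *)
Lemma pd_le_dsum (R : pzRingType) n (M : lmodType R) (X : choiceType)
    (B : set X) : pd_le n M -> pd_le n (dsum M B).
Proof.
elim: n M => [|n IH] M /=; first exact: dsum_projective.
move=> [P [g [pP gs pdK]]].
exists (dsum P B), (dsum_map B g); split.
- exact: dsum_projective.
- exact: dsum_map_surj.
have [i iE] : exists i : {linear dsum (kermod g) B -> kermod (dsum_map B g)},
    forall x, kerval (i x) = dsum_map B (@kerval _ _ _ g) x.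
  apply: kermod_corestr => x; apply: dsumP => y.
  exact: kermodP.
apply: (pd_le_iso (f := i)) (IH _ pdK).
  move=> u v uv; apply: dsumP => x; apply: kerval_inj.
  have := congr1 (@kerval _ _ _ (dsum_map B g)) uv; rewrite !iE.
  by move=> /(congr1 (fun d => dval d x)).
move=> y.
have gy x : g (dval (kerval y) x) = 0.
  by have := congr1 (fun d => dval d x) (kermodP y).
have zP : (fun x => KerMod (introT eqP (gy x)) : kermod g)
    \in dsum_pred (M := kermod g) B.
  have /asboolP[fa aB] := dvalP (kerval y).
  set z := fun x => _.
  have sub : [set x | z x != 0] `<=` [set x | dval (kerval y) x != 0].
    by move=> x /=; apply: contra_neq => yx; apply: kerval_inj.
  apply/asboolP; split; first exact: sub_finite_set sub fa.
  by move=> x /sub /aB.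
exists (Dsum zP); apply: kerval_inj; rewrite iE.
by apply: dsumP.
Qed.

Section QuotientModule.
Variables (R : pzRingType) (M : lmodType R).

Record submodule := Submodule {
  submod_set :> M -> Prop;
  submod0 : submod_set 0;
  submodP : forall c u v,
    submod_set u -> submod_set v -> submod_set (c *: u + v) }.

Lemma submodD (S : submodule) u v : S u -> S v -> S (u + v).
Proof. by move=> Su; rewrite -[u]scale1r; apply: submodP. Qed.
Lemma submodZ (S : submodule) c u : S u -> S (c *: u).
Proof.
by move=> Su; rewrite -[c *: u]addr0; apply: submodP => //; apply: submod0.
Qed.
Lemma submodB (S : submodule) u v : S u -> S v -> S (u - v).
Proof. by move=> Su Sv; rewrite addrC -scaleN1r; apply: submodP. Qed.
Lemma submodN (S : submodule) u : S u -> S (- u).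
Proof. by rewrite -scaleN1r; apply: submodZ. Qed.
Lemma submod_sum (S : submodule) (I : Type) (r : seq I) (F : I -> M) :
  (forall i, S (F i)) -> S (\sum_(i <- r) F i).
Proof.
move=> SF; elim: r => [|i r IH]; rewrite ?big_nil ?big_cons.
  exact: submod0.
exact: submodD.
Qed.

Variable S : submodule.

Definition submod_pred : {pred M} := fun x => `[< S x >].

Lemma submod_zmod : zmod_closed submod_pred.
Proof.
split=> [|x y /asboolP xS /asboolP yS]; apply/asboolP; first exact: submod0.
exact: submodB.
Qed.

HB.instance Definition _ := GRing.isZmodClosed.Build M submod_pred submod_zmod.

Definition quotmod : Type := Quotient.quot submod_pred.
HB.instance Definition _ := GRing.Zmodule.on quotmod.

Definition mproj (x : M) : quotmod := \pi_(Quotient.quot submod_pred) x.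
Definition mrepr (x : quotmod) : M := repr (x : (Quotient.quot submod_pred)).

Lemma mreprK x : mproj (mrepr x) = x. Proof. exact: reprK. Qed.

Lemma mproj_eqP x y : mproj x = mproj y <-> S (x - y).
Proof.
split; first by move/eqP; rewrite -Quotient.idealrBE => /asboolP.
by move=> h; apply/eqP; rewrite -Quotient.idealrBE; apply/asboolP.
Qed.

Lemma mreprP x : S (mrepr (mproj x) - x).
Proof. by apply/mproj_eqP; rewrite mreprK. Qed.

Lemma mproj_is_zmod_morphism : zmod_morphism mproj.
Proof. exact: (raddfB \pi_(Quotient.quot submod_pred)). Qed.
HB.instance Definition _ :=
  GRing.isZmodMorphism.Build M quotmod mproj mproj_is_zmod_morphism.

Definition mscale (a : R) (x : quotmod) : quotmod := mproj (a *: mrepr x).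

Lemma mscaleE a x : mscale a (mproj x) = mproj (a *: x).
Proof. by apply/mproj_eqP; rewrite -scalerBr; apply/submodZ/mreprP. Qed.

Fact mscaleA a b x : mscale a (mscale b x) = mscale (a * b) x.
Proof. by rewrite -[x]mreprK !mscaleE scalerA. Qed.
Fact mscale1 : left_id 1 mscale.
Proof. by move=> x; rewrite -[x]mreprK mscaleE scale1r. Qed.
Fact mscaleDr : right_distributive mscale +%R.
Proof.
move=> a x y; rewrite -[x]mreprK -[y]mreprK -raddfD !mscaleE -raddfD.
by rewrite scalerDr.
Qed.
Fact mscaleDl x : {morph mscale^~ x : a b / a + b}.
Proof. by move=> a b; rewrite -[x]mreprK !mscaleE -raddfD scalerDl. Qed.

HB.instance Definition _ := GRing.Zmodule_isLmodule.Build R quotmod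
  mscaleA mscale1 mscaleDr mscaleDl.

Lemma mproj_linear : linear mproj.
Proof.
move=> c x y; rewrite -[c *: mproj x]/(mscale c (mproj x)) mscaleE.
exact: raddfD.
Qed.

Lemma quotient_exists : exists (N : lmodType R) (p : {linear M -> N}),
  (forall y, exists x, p x = y) /\ (forall x, p x = 0 <-> S x).
Proof.
exists quotmod, (linear_of mproj_linear); split.
  by move=> y; exists (mrepr y); apply: mreprK.
move=> x /=; rewrite -[X in S X]subr0 -mproj_eqP.
by rewrite (raddf0 mproj).
Qed.

End QuotientModule.

(** * The radical of a bound quiver algebra *)

Section BasicAlgebra.
Variables (k : fieldType) (Q : quiver) (I : admissible_ideal k Q).
Local Notation R := (bqa I).

(** The structure map from k to the algebra. *)
Definition kconst (c : k) : R := qproj I (c *: (1 : path_algebra k Q)).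
(** Membership in the Jacobson radical, which is the common kernel of the
    augmentations at the vertices. *)
Definition in_rad (a : R) : Prop := forall x, vaug x a = 0.

Lemma pa_scale_mull c (u v : path_algebra k Q) : (c *: u) * v = c *: (u * v).
Proof.
by rewrite -[c *: u]addr0 [LHS]pa_mul_linearl pa_0mul addr0.
Qed.

Lemma kconstM c d : kconst c * kconst d = kconst (c * d).
Proof. by rewrite /kconst -rmorphM pa_scale_mull mul1r scalerA. Qed.
Lemma kconst1 : kconst 1 = 1.
Proof. by rewrite /kconst scale1r rmorph1. Qed.
Lemma kconstD c d : kconst (c + d) = kconst c + kconst d.
Proof. by rewrite /kconst scalerDl raddfD. Qed.
Lemma kconst0 : kconst 0 = 0.
Proof. by rewrite /kconst scale0r raddf0. Qed.

Lemma vaug_kconst x c : vaug x (kconst c) = c.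
Proof.
rewrite /kconst vaug_proj pa_coefZ; have := vaug1 I x.
by rewrite -(rmorph1 (qproj I)) vaug_proj => ->; rewrite mulr1.
Qed.

Lemma vaug0 x : vaug x (0 : R) = 0.
Proof. by rewrite -(raddf0 (qproj I)) vaug_proj. Qed.

Lemma vaugN x (a : R) : vaug x (- a) = - vaug x a.
Proof. by apply/eqP; rewrite -addr_eq0 -vaugD addNr vaug0. Qed.

Lemma vaug_videm x y : vaug x (videm I y) = (x == y)%:R.
Proof.
rewrite /videm vaug_proj pa_coef_kpath; congr (_%:R).
by apply: congr1; apply/eqP/eqP => [[]|->].
Qed.

Lemma sum_videm : \sum_x videm I x = 1.
Proof. by rewrite -(rmorph1 (qproj I)) -raddf_sum. Qed.

Lemma in_radMl a b : in_rad b -> in_rad (a * b).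
Proof. by move=> rb x; rewrite vaugM rb mulr0. Qed.
Lemma in_radMr a b : in_rad a -> in_rad (a * b).
Proof. by move=> ra x; rewrite vaugM ra mul0r. Qed.

(** Modulo the radical the algebra is a product of copies of k, one for each
    vertex.  This lemma and the next say so on either side of an idempotent. *)
Lemma mul_videm a x :
  exists2 r, in_rad r & a * videm I x = kconst (vaug x a) * videm I x + r.
Proof.
exists (a * videm I x - kconst (vaug x a) * videm I x);
  last by rewrite addrC subrK.
move=> y; rewrite vaugD vaugN !vaugM vaug_kconst vaug_videm.
by case: eqVneq => [->|_]; rewrite ?mulr0 subrr.
Qed.

Lemma videm_mul a x :
  exists2 r, in_rad r & videm I x * a = kconst (vaug x a) * videm I x + r.
Proof.
exists (videm I x * a - kconst (vaug x a) * videm I x);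
  last by rewrite addrC subrK.
move=> y; rewrite vaugD vaugN !vaugM vaug_kconst vaug_videm.
by case: eqVneq => [->|_]; rewrite ?mulr0 ?mul0r ?subrr // mulrC subrr.
Qed.

Lemma kpath_arrow_ideal (p : qpath Q) :
  (forall x, p != ptriv x) -> arrow_ideal k Q (kpath k p).
Proof.
case: p => -[x [|a w]] /= pw nt.
  by have /eqP[] := nt x; apply: val_inj.
case/andP: (pw) => /eqP ax wP.
pose q : qpath Q := exist _ (tgt a, w) wP.
have E : Defs.pcomp q (parrow a) = Some (exist _ (x, a :: w) pw).
  by apply/pcompP; split=> //=; rewrite /pstart /= ax.
have -> : kpath k (exist _ (x, a :: w) pw) = kpath k q * kpath k (parrow a).
  by rewrite -[RHS]/(pa_mul _ _) pa_mul_kpath /kpath_mul E.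
by move=> J SJ; apply: idealMl; apply: SJ; exists a.
Qed.

Lemma ideal_scale (J : ideal (path_algebra k Q)) c u : J u -> J (c *: u).
Proof. by move=> Ju; rewrite -[u]mul1r -pa_scale_mull; apply: idealMl. Qed.

Lemma idealD (A : pzRingType) (J : ideal A) u v : J u -> J v -> J (u + v).
Proof.
move=> Ju Jv; rewrite -[v]opprK; apply: idealB => //.
by rewrite -sub0r; apply: idealB => //; apply: ideal0.
Qed.

(** The radical is the image of the arrow ideal, because every nontrivial path
    is a multiple of an arrow; this is what turns the admissibility bound into
    the nilpotence of the radical. *)
Lemma arrow_idealP (u : path_algebra k Q) :
  (forall x, u (ptriv x) = 0) -> arrow_ideal k Q u.
Proof.
move=> u0.
(* The trivial part of v: subtracting it makes the claim linear in u. *)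
pose t (v : path_algebra k Q) := \sum_x v (ptriv x) *: kpath k (ptriv x).
suff : arrow_ideal k Q (u - t u).
  by rewrite /t big1 ?subr0 // => x _; rewrite u0 scale0r.
elim/pa_ind: u {u0} => [|c p a IH].
  rewrite /t big1 ?subr0; first exact: ideal0.
  by move=> x _; rewrite pa_coef0 scale0r.
have tE : t (c *: kpath k p + a) = c *: t (kpath k p) + t a.
  rewrite /t scaler_sumr -big_split; apply: eq_bigr => x _.
  by rewrite pa_coefD pa_coefZ scalerDl scalerA.
rewrite tE opprD addrACA -scalerBr; apply: idealD => //; apply: ideal_scale.
have [[x /eqP->]|nt] := pselect (exists x, p == ptriv x); last first.
  rewrite /t big1 ?subr0 => [|x _].
    by apply: kpath_arrow_ideal => x; apply/negP => px; apply: nt; exists x.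
  rewrite pa_coef_kpath eq_sym; case: eqVneq => [px|_]; last by rewrite scale0r.
  by case: nt; exists x; rewrite px.
rewrite /t (bigD1 x) //= big1 => [|y yx].
  by rewrite addr0 eqxx scale1r subrr => J _; apply: ideal0.
case: eqVneq => [[yx']|_]; last by rewrite scale0r.
by rewrite yx' eqxx in yx.
Qed.

Lemma in_rad_lift a : in_rad a -> arrow_ideal k Q (qrepr a).
Proof. by move=> ra; apply: arrow_idealP => x; apply: ra. Qed.

(** The i-th power of the radical annihilates u.  The recursion multiplies u by
    one radical element at a time, which avoids powers of an ideal. *)
Fixpoint rad_kills (M : lmodType R) (i : nat) (u : M) : Prop :=
  if i is i'.+1 then forall a, in_rad a -> rad_kills i' (a *: u) else u = 0.

Lemma rad_kills_linear (M : lmodType R) i c (u v : M) :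
  rad_kills i u -> rad_kills i v -> rad_kills i (c *: u + v).
Proof.
elim: i c u v => [|i IH] c u v /=; first by move=> -> ->; rewrite scaler0 addr0.
move=> ku kv a ra; rewrite scalerDr scalerA -[X in X + _]scale1r.
by apply: IH; [apply: ku; apply: in_radMr | apply: kv].
Qed.

Lemma rad_kills0 (M : lmodType R) i : rad_kills i (0 : M).
Proof. by elim: i => //= i IH a _; rewrite scaler0. Qed.

Lemma rad_kills_inj (M N : lmodType R) (f : {linear M -> N}) i u :
  injective f -> rad_kills i (f u) -> rad_kills i u.
Proof.
move=> fi; elim: i u => [|i IH] u /=.
  by move=> fu; apply: fi; rewrite fu raddf0.
by move=> ku a ra; apply: IH; rewrite linearZ; apply: ku.
Qed.

(** Each radical element lifts to the arrow ideal, so m of them multiply to the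
    image of an element of its m-th power, which lies in I. *)
Lemma rad_nilpotent : exists m, forall (M : lmodType R) (u : M), rad_kills m u.
Proof.
have [m _ [FI _]] := adm_bounds I; exists m => M u.
suff H j i w : (i + j)%N = m -> ideal_pow (arrow_ideal k Q) i w ->
    forall v : M, rad_kills j (qproj I w *: v).
  by rewrite -[u]scale1r -(rmorph1 (qproj I)); apply: (H m 0).
elim: j i w => [|j IH] i w ijm wF v /=.
  rewrite addn0 in ijm; rewrite ijm in wF; move/FI: wF => wI.
  have -> : qproj I w = 0; last by rewrite scale0r.
  by rewrite -(raddf0 (qproj I)); apply/qproj_eqP; rewrite subr0.
move=> a ra; rewrite scalerA -[a]qreprK -rmorphM.
apply: (IH i.+1); first by rewrite addSnnS.
by apply: sub_addspan; exists (qrepr a), w; split=> //; apply: in_rad_lift.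
Qed.

Definition rad_kills_sub (M : lmodType R) i : submodule M :=
  Submodule (rad_kills0 M i) (fun c u v => @rad_kills_linear M i c u v).

(** The submodule J M, with J the radical of the algebra. *)
Definition rad_module (M : lmodType R) : submodule M.
Proof.
exists (fun x => forall S : submodule M,
  (forall a u, in_rad a -> S (a *: u)) -> S x).
- by move=> S _; apply: submod0.
- by move=> c u v uJ vJ S SJ; apply: submodP; [apply: uJ | apply: vJ].
Defined.

Lemma rad_moduleZ (M : lmodType R) a (u : M) :
  in_rad a -> rad_module M (a *: u).
Proof. by move=> ra S; apply. Qed.

Definition submod_preim (M N : lmodType R) (f : {linear M -> N})
    (S : submodule N) : submodule M.
Proof.
exists (fun x => S (f x)); first by rewrite raddf0; apply: submod0.
by move=> c u v Su Sv; rewrite linearP; apply: submodP.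
Defined.

Lemma rad_module_map (M N : lmodType R) (f : {linear M -> N}) u :
  rad_module M u -> rad_module N (f u).
Proof.
move=> /(_ (submod_preim f (rad_module N))); apply=> a v ra /=.
by rewrite linearZ; apply: rad_moduleZ.
Qed.

Lemma rad_module_kills (M : lmodType R) i :
  (forall u : M, rad_kills i.+1 u) -> forall u, rad_module M u -> rad_kills i u.
Proof.
move=> kM u /(_ (rad_kills_sub M i)); apply=> a v ra.
exact: kM.
Qed.

Lemma sum_videm_scale (M : lmodType R) (u : M) : \sum_x videm I x *: u = u.
Proof. by rewrite -scaler_suml sum_videm scale1r. Qed.

End BasicAlgebra.

(** * Extending maps along thin kernels *)

Section Extension.
Variables (k : fieldType) (Q : quiver) (I : admissible_ideal k Q).
Local Notation R := (bqa I).
Variables (K F : lmodType R) (i : {linear K -> F}).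
(* For F projective and i injective with cokernel M, this says that J F meets K
   in J K, which is the vanishing of Tor_1 of M against all the simple right
   modules. *)
Hypothesis iH : forall u, rad_module F (i u) -> rad_module K u.

(** A complement of K modulo the radicals, maximal among the submodules that
    contain J F and meet K inside J K.  A vector outside its sum with K can be
    chosen homogeneous (fixed by a vertex idempotent); such a vector spans a
    line modulo J F, and adding this line contradicts maximality. *)
Lemma radical_complement : exists W : submodule F,
  [/\ forall v, rad_module F v -> W v,
      forall u, W (i u) -> rad_module K u
    & forall v, exists w u, W w /\ v = w + i u].
Proof.
(* The empty set is admitted only as the union of the empty chain. *)
pose ok (W : set F) := [/\ W 0,
  forall c u v, W u -> W v -> W (c *: u + v),
  forall v, rad_module F v -> W v & forall u, W (i u) -> rad_module K u].
have [|A [Aok Amax]] := @Zorn_bigcup F [set W | W = set0 \/ ok W].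
  move=> C CP Ctot.
  have [[W0 CW0 W0ok]|noW] := pselect (exists2 W, C W & ok W); last first.
    left; apply/seteqP; split=> // x [W CW Wx].
    have [W0|Wok] := CP W CW; first by rewrite W0 in Wx.
    by case: noW; exists W.
  have Cok W u : C W -> W u -> ok W.
    by move=> CW Wu; have [E|//] := CP W CW; rewrite E in Wu.
  right; split.
  - by exists W0 => //; case: W0ok.
  - move=> c u v [U CU Uu] [V CV Vv].
    have [UV|VU] := Ctot U V CU CV.
      by exists V => //; have [_ + _ _] := Cok V v CV Vv; apply=> //; apply: UV.
    by exists U => //; have [_ + _ _] := Cok U u CU Uu; apply=> //; apply: VU.
  - by move=> v rv; exists W0 => //; case: W0ok => _ _ + _; apply.
  - by move=> u [W CW Wu]; have [_ _ _] := Cok W _ CW Wu; apply.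
have {Aok}[A0|[A0 AP radA Ai]] := Aok.
  have okrad : ok (rad_module F).
    split=> //; first exact: submod0.
    by move=> c u v; apply: submodP.
  case: (Amax (rad_module F)); last by right.
  rewrite A0; split; first by move=> x [].
  by move=> /(_ 0); apply; apply: submod0.
pose W := Submodule A0 AP; exists W; split=> // v.
pose sumWi v := exists w u, W w /\ v = w + i u.
apply: contrapT => nv.
have [x nx] : exists x, ~ sumWi (videm I x *: v).
  apply: contrapT => all_x; apply: nv.
  have sx x : sumWi (videm I x *: v).
    by apply: contrapT => nx; apply: all_x; exists x.
  pose w x := sval (cid (sx x)).
  have wE x : exists u, W (w x) /\ videm I x *: v = w x + i u.
    by rewrite /w; case: cid.
  pose u x := sval (cid (wE x)).
  have uE x : W (w x) /\ videm I x *: v = w x + i (u x).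
    by rewrite /u; case: cid.
  exists (\sum_x w x), (\sum_x u x); split.
    by apply: submod_sum => x; case: (uE x).
  rewrite raddf_sum -big_split /= -[LHS]sum_videm_scale.
  by apply: eq_bigr => x _; case: (uE x).
pose v' := videm I x *: v.
pose A' : set F := [set z | exists w c, W w /\ z = w + kconst I c *: v'].
have WA' : A `<=` A'.
  by move=> w Aw; exists w, 0; split; rewrite // kconst0 scale0r addr0.
case: (Amax A').
  split=> // /(_ v') A'v; apply: nx; exists v', 0; split.
    by apply: A'v; exists 0, 1; rewrite kconst1 scale1r add0r.
  by rewrite raddf0 addr0.
right; split.
- exact/WA'.
- move=> a z z' [w [c [Ww ->]]] [w' [c' [Ww' ->]]].
  have [r rr rE] := mul_videm (a * kconst I c) x.
  exists (a *: w + r *: v + w'), (vaug x (a * kconst I c) + c'); split.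
    apply: submodD => //; apply: submodD; first exact: submodZ.
    by apply: radA; apply: rad_moduleZ.
  rewrite kconstD [(_ + kconst I c') *: _]scalerDl [RHS]addrACA.
  rewrite scalerDr scalerA /v' [(a * kconst I c) *: _]scalerA rE.
  rewrite scalerDl -scalerA.
  by rewrite [kconst I _ *: _ + _ in LHS]addrC !addrA.
- by move=> z /radA/WA'.
- move=> u [w [c [Ww uE]]]; have [c0|c0] := eqVneq c 0.
    by apply: Ai; rewrite uE c0 kconst0 scale0r addr0.
  case: nx; exists (- (kconst I c^-1 *: w)), (kconst I c^-1 *: u); split.
    by apply/submodN/submodZ.
  have -> : i (kconst I c^-1 *: u) = kconst I c^-1 *: (w + kconst I c *: v').
    by rewrite -uE linearZ.
  rewrite scalerDr addKr scalerA kconstM mulVf //.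
  by rewrite kconst1 scale1r.
Qed.

(** A map from K to a module killed by J vanishes on J K, so it can be extended
    by zero on the complement. *)
Lemma extend_semisimple (Y : lmodType R) (f : {linear K -> Y}) :
  (forall y : Y, rad_kills 1 y) ->
  exists g : {linear F -> Y}, forall u, g (i u) = f u.
Proof.
move=> Y1; have [W [radW Wi Wsum]] := radical_complement.
have f0 u : rad_module K u -> f u = 0.
  by move=> /(rad_module_map f)/(rad_module_kills Y1).
pose w v := sval (cid (Wsum v)).
have wE v : exists u, W (w v) /\ v = w v + i u by rewrite /w; case: cid.
pose u v := sval (cid (wE v)).
have uE v : W (v - i (u v)).
  by rewrite /u; case: cid => /= z [Ww vE]; rewrite [X in X - _]vE addrK.
have fu v z : W (v - i z) -> f (u v) = f z.
  move=> Wz; apply/eqP; rewrite -subr_eq0 -raddfB; apply/eqP/f0/Wi.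
  rewrite raddfB; have -> : i (u v) - i z = v - i z - (v - i (u v)).
    by rewrite opprB [RHS]addrC addrA subrK.
  exact: submodB.
have gl : linear (fun v => f (u v)).
  move=> c a b; rewrite -linearP; apply: fu.
  rewrite linearP; have -> : c *: a + b - (c *: i (u a) + i (u b))
     = c *: (a - i (u a)) + (b - i (u b)).
    by rewrite scalerBr opprD addrACA.
  exact: submodP.
exists (linear_of gl) => z /=; apply: fu.
by rewrite subrr; apply: submod0.
Qed.

Hypothesis pF : projective F.

(** Induction on the nilpotence degree of X: extend the composite with
    X -> X / J X, lift this extension to X by projectivity of F, and correct
    the lift by an extension of the error, which takes its values in J X. *)
Lemma extend_nilpotent n (X : lmodType R) (f : {linear K -> X}) :
  (forall y : X, rad_kills n y) ->
  exists g : {linear F -> X}, forall u, g (i u) = f u.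
Proof.
elim: n X f => [|n IH] X f Xn.
  by exists \0 => u /=; rewrite (Xn (f u)).
have [Y [p [ps pE]]] := quotient_exists (rad_module X).
have [|g gE] := extend_semisimple (p \o f).
  by move=> y a ra; have [x <-] := ps y; rewrite -linearZ; apply/pE/rad_moduleZ.
have [h hE] := pF g ps.
have dl : linear (fun u => f u - h (i u)).
  move=> c u v; rewrite (linearP f) (linearP i) (linearP h).
  by rewrite scalerBr opprD addrACA.
have [|d dE] := kermod_corestr (f := p) (h := linear_of dl).
  by move=> u /=; rewrite raddfB /= hE gE subrr.
have [|g' g'E] := IH _ d.
  move=> y; apply: (rad_kills_inj (f := @kerval _ _ _ p)).
    exact: kerval_inj.
  apply: rad_module_kills => //; apply/pE/kermodP.
have sl : linear (fun v => h v + kerval (g' v)).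
  by move=> c u v; rewrite (linearP h) (linearP g') linearP scalerDr addrACA.
exists (linear_of sl) => u /=; rewrite g'E dE /=.
by rewrite addrC subrK.
Qed.

End Extension.

Section ProjectivityCriterion.
Variables (k : fieldType) (Q : quiver) (I : admissible_ideal k Q).
Local Notation R := (bqa I).

(** Extending the identity of the kernel to F splits the kernel off, which makes
    M a direct summand of F.  For modules of finite length this is the usual
    fact that a vanishing Tor_1 against the simples forces projectivity; the
    nilpotence of the radical makes it true without finiteness. *)
Lemma projective_of_thin_kernel (F M : lmodType R) (g : {linear F -> M}) :
  projective F -> (forall y, exists x, g x = y) ->
  (forall u : kermod g, rad_module F (kerval u) -> rad_module (kermod g) u) ->
  projective M.
Proof.
move=> pF gs thin; have [m Rm] := rad_nilpotent I.
pose idK : {linear kermod g -> kermod g} := idfun.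
have [r rE] := extend_nilpotent thin pF idK (Rm _).
pose s0 y := sval (cid (gs y)).
have s0E y : g (s0 y) = y by rewrite /s0; case: cid.
(* The correction by r makes the section independent of the preimage. *)
pose s y := s0 y - kerval (r (s0 y)).
have sP y v : g v = y -> s y = v - kerval (r v).
  move=> gv; have [|z zE] := kermod_lift (f := g) (x := s0 y - v).
    by rewrite raddfB /= s0E gv subrr.
  have /eqP : kerval (r (s0 y)) - kerval (r v) = s0 y - v.
    by rewrite -!raddfB -zE /=; congr kerval; apply: rE.
  rewrite subr_eq /s => /eqP ->.
  by rewrite opprD opprB addrA addrCA subrr addr0.
have sl : linear s.
  move=> c a b; rewrite (sP _ (c *: s0 a + s0 b)); last by rewrite linearP !s0E.
  rewrite /s (linearP r) (linearP (@kerval _ _ _ g)).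
  by rewrite scalerBr opprD addrACA.
apply: (projective_retract (s := linear_of sl) (r := g)) => // y.
by rewrite /= /s raddfB /= s0E kermodP subr0.
Qed.

End ProjectivityCriterion.

(** * Tor against the simple right modules *)

Lemma homology_trivial (A B C : zmodType) (f : {additive A -> B})
    (g : {additive B -> C}) : (forall v : homology f g, v = 0) ->
  forall b, g b = 0 -> exists a, f a = b.
Proof.
move=> H0 b /eqP gb; pose z : cycles g := Cycle gb.
have /eqP : (\pi_(Quotient.quot (boundary_pred f (g := g))) z : homology f g)
  = \pi_(Quotient.quot (boundary_pred f (g := g))) 0.
  by rewrite [LHS]H0 [RHS]H0.
by rewrite -Quotient.idealrBE subr0 => /asboolP.
Qed.

Section TorSimple.
Variables (k : fieldType) (Q : quiver) (I : admissible_ideal k Q).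
Local Notation R := (bqa I).

Section Tensor.
Variables (x : Q) (M : lmodType R).
Local Notation S := (simple_right I x).
Local Notation one := ((1 : k) : S).

Lemma simple_right_scale (a : R) (c : S) :
  (a : R^c) *: c = ((c : k) * vaug x a : k).
Proof. by []. Qed.

Lemma tensB (v w : M) : tens one (v - w) = tens one v - tens one w.
Proof. by apply/eqP; rewrite eq_sym subr_eq -tensDr subrK. Qed.

Lemma tens_scale (a : R) (v : M) :
  tens one (a *: v) = tens (vaug x a : S) v.
Proof.
by rewrite -tensZ; congr (tens _ v); rewrite simple_right_scale mul1r.
Qed.

Lemma tens_rad (v : M) : rad_module M v -> tens one v = 0.
Proof.
have t0 : tens one (0 : M) = 0 by rewrite -[X in tens _ X](subrr 0) tensB subrr.
have s0 (v' : M) : tens (0 : S) v' = 0.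
  by apply: (addrI (tens (0 : S) v')); rewrite -tensDl !addr0.
pose T (u : M) := forall a : R, tens one (a *: u) = 0.
have T0 : T 0 by move=> a; rewrite scaler0.
have TP c u w : T u -> T w -> T (c *: u + w).
  by move=> Tu Tw a; rewrite scalerDr scalerA tensDr Tu Tw addr0.
move=> /(_ (Submodule T0 TP)) /=; rewrite -[v in tens _ v]scale1r; apply.
by move=> a u ra b; rewrite scalerA tens_scale (in_radMl b ra) s0.
Qed.

(** The bilinear map (c, m) |-> c e_x m is balanced only modulo J M.  It detects
    when an elementary tensor vanishes. *)
Definition simple_tensor_gen (p : S * M) : zmodule M :=
  kconst I p.1 *: (videm I x *: p.2).

Definition simple_tensor (z : freemod int (S * M)%type) : M :=
  flift simple_tensor_gen z.

Lemma simple_tensorB y z :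
  simple_tensor (y - z) = simple_tensor y - simple_tensor z.
Proof. exact: (raddfB (flift simple_tensor_gen)). Qed.

Lemma simple_tensor_basis s m :
  simple_tensor (fbasis int (s, m)) = kconst I s *: (videm I x *: m).
Proof. exact: (flift_basis simple_tensor_gen). Qed.

Lemma simple_tensor_rad z :
  addspan (@tensor_relations R S M) z -> rad_module M (simple_tensor z).
Proof.
move=> /(_ [set y | rad_module M (simple_tensor y)]); apply.
- rewrite /mkset -[0](subrr 0) simple_tensorB subrr; exact: submod0.
- by move=> u v ru rv; rewrite /mkset simple_tensorB; apply: submodB.
- move=> {}z; case=> [[m [m' [n ->]]]|[[m [n [n' ->]]]|[m [a [n ->]]]]];
    rewrite /mkset !simple_tensorB !simple_tensor_basis.
  + rewrite kconstD scalerDl addrAC addrK subrr; exact: submod0.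
  + rewrite !scalerDr addrAC addrK subrr; exact: submod0.
  + have [r rr E] := videm_mul a x.
    rewrite simple_right_scale [videm I x *: (a *: n)]scalerA E scalerDl.
    rewrite scalerDr -scalerA [kconst I m *: (kconst I _ *: _)]scalerA kconstM.
    by rewrite opprD addrA subrr add0r; apply/submodN/submodZ/rad_moduleZ.
Qed.

Lemma tens_simple_zero (v : M) :
  tens one v = 0 -> rad_module M (videm I x *: v).
Proof.
move=> tv; have /tproj_eqP : tproj (fbasis int (one, v)) = tproj 0.
  by rewrite [LHS]tv raddf0.
rewrite subr0 => /simple_tensor_rad; rewrite simple_tensor_basis.
by rewrite kconst1 scale1r.
Qed.

Lemma tens_simple_surj (t : tensor S M) : exists v, t = tens one v.
Proof.
rewrite -[t]treprK; pose T (z : freemod int (S * M)%type) :=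
  exists v, tproj z = tens one v.
have TB y z : T y -> T z -> T (y - z).
  by move=> [v vE] [w wE]; exists (v - w); rewrite tensB -vE -wE raddfB.
have T0 : T 0 by exists 0; rewrite raddf0 -[X in tens _ X](subrr 0) tensB subrr.
have TD y z : T y -> T z -> T (y + z).
  move=> Ty Tz; rewrite -[z]opprK -[- z]sub0r.
  by apply: (TB) => //; apply: (TB).
elim/freemod_ind: (trepr t) => [|c [s m] z IH]; first exact: T0.
apply: (TD) => //; have Tb : T (fbasis int (s, m)).
  exists (kconst I s *: m); rewrite tens_scale vaug_kconst.
  by [].
have Tn n : T (n%:Z *: fbasis int (s, m)).
  elim: n => [|n IHn]; first by rewrite scale0r.
  by rewrite intS scalerDl scale1r; apply: (TD).
case: c => n; first exact: Tn.
by rewrite NegzE scaleNr -sub0r; apply: (TB).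
Qed.

End Tensor.

(** Write S for the syzygy and d for the differentials.  If u in S_(n+1) lies in
    the radical of P_n, lift it to p in P_(n+1); the tensor 1 (x) p is a cycle,
    hence a boundary 1 (x) d q.  Then e_x (p - d q) is in the radical of
    P_(n+1), and its image in S_(n+1) is e_x u. *)
Lemma thin_of_Tor (N : lmodType R) n :
  (forall x (v : Tor (simple_right I x) N n.+1), v = 0) ->
  forall u : syzygy N n.+1,
    rad_module (freemod R (syzygy N n)) (kerval u) ->
    rad_module (syzygy N n.+1) u.
Proof.
move=> T0 u ru; have [p pE] := flift_id_surj u.
rewrite -[u]sum_videm_scale; apply: submod_sum => x.
pose one : simple_right I x := (1 : k).
have [|t tE] := homology_trivial (T0 x) (b := tens one p).
  rewrite -[LHS]/(tensor_map _ (cdiff (std_complex N) n) (tens one p)).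
  by rewrite tensor_map_tens /= pE; apply: tens_rad.
have [q qE] := tens_simple_surj t.
have {}tE : tens one (cdiff (std_complex N) n.+1 q) = tens one p.
  by rewrite -tensor_map_tens -qE.
have : tens one (p - cdiff (std_complex N) n.+1 q) = 0.
  by rewrite tensB -tE subrr.
move/tens_simple_zero => /(rad_module_map (flift (@id (syzygy N n.+1)))).
rewrite linearZ raddfB /= pE.
by rewrite kermodP subr0.
Qed.

Lemma syzygy_projective_of_Tor (N : lmodType R) n :
  (forall x (v : Tor (simple_right I x) N n.+1), v = 0) ->
  projective (syzygy N n).
Proof.
move=> T0.
apply: (@projective_of_thin_kernel _ _ _ _ _ (flift (@id (syzygy N n)))).
- exact: freemod_projective.
- exact: flift_id_surj.
- exact: thin_of_Tor T0.
Qed.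

End TorSimple.

(** * From the simple modules to all modules *)

Section SemisimpleModules.
Variables (k : fieldType) (Q : quiver) (I : admissible_ideal k Q).
Local Notation R := (bqa I).

Section Isotypic.
Variables (y : Q) (V : lmodType R).
Hypothesis Vy : forall (a : R) (v : V), a *: v = kconst I (vaug y a) *: v.
Local Notation S := (simple_left I y).

(** The map from the simple module at y that sends 1 to v. *)
Fact embed_simple_linear (v : V) : linear (fun c : S => kconst I (c : k) *: v).
Proof.
move=> a c d; rewrite [X in kconst I X]/GRing.add /= kconstD scalerDl.
congr (_ + _).
by rewrite [in RHS]Vy scalerA kconstM.
Qed.

Definition embed_simple (v : V) : {linear S -> V} :=
  linear_of (embed_simple_linear v).

Lemma embed_simpleE v c : embed_simple v c = kconst I (c : k) *: v.
Proof. by []. Qed.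

(** B is a k-basis of V, obtained as a maximal linearly independent set. *)
Lemma isotypic_basis : exists B : set V,
  injective (dlift embed_simple : dsum S B -> V) /\
  forall v, exists a : dsum S B, dlift embed_simple a = v.
Proof.
pose free (B : set V) := forall a : dsum S B, dlift embed_simple a = 0 -> a = 0.
have [|B [Bfree Bmax]] := @Zorn_bigcup V free.
  move=> C Cfree Ctot a a0; have [s us sP] := dsum_seq a.
  (* The support of a is finite, so it lies in a single member of the chain,
     unless it is empty. *)
  have [[W CW aW]|none] :
      (exists2 W, C W & forall x, x \in s -> dval a x != 0 -> W x)
      \/ (forall x, x \in s -> dval a x = 0).
    elim: s {us sP} => [|x s [[W CW sW]|IH]]; first by right.
      have [ax|/dsum_support[U CU Ux]] := eqVneq (dval a x) 0.
        left; exists W => // z; rewrite inE => /predU1P[->|]; last exact: sW.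
        by rewrite ax eqxx.
      left; have [UW|WU] := Ctot U W CU CW.
        exists W => // z; rewrite inE => /predU1P[-> _|]; first exact: UW.
        exact: sW.
      exists U => // z; rewrite inE => /predU1P[->//|zs az].
      by apply: WU; apply: sW.
    have [ax|/dsum_support[U CU Ux]] := eqVneq (dval a x) 0.
      by right=> z; rewrite inE => /predU1P[->//|]; apply: IH.
    left; exists U => // z; rewrite inE => /predU1P[->//|/IH ->].
    by rewrite eqxx.
  - have [|a' a'E] := dsum_change (a := a) (B' := W).
      by move=> x ax; apply: aW => //; apply: sP.
    have a'0 := Cfree W CW a'; rewrite (dlift_change embed_simple a'E) in a'0.
    by apply: dsumP => x; rewrite -a'E a'0.
  - apply: dsumP => x; rewrite dval0; apply/eqP; apply: contraT => ax.
    by case/eqP: (ax); apply/none/sP.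
exists B; split; first by apply: raddf_inj.
move=> v; apply: contrapT => nv.
have span_scale c w : (exists a : dsum S B, dlift embed_simple a = w) ->
    exists a : dsum S B, dlift embed_simple a = kconst I c *: w.
  by move=> [a <-]; exists (kconst I c *: a); rewrite linearZ.
have nBv : ~ B v.
  move=> Bv; apply: nv; exists (dsum_in B v ((1 : k) : S)).
  by rewrite dlift_in // embed_simpleE kconst1 scale1r.
pose B' := B `|` [set v].
case: (Bmax B').
  split; first by left.
  by move=> /(_ v) B'B; apply: nBv; apply: B'B; right.
move=> a a0; pose c := dval a v.
have B'v : B' v by right.
have [|a' a'E] := dsum_change (a := a - dsum_in B' v c) (B' := B).
  move=> x; rewrite dvalB dsum_inE (asboolT B'v) andbT.
  case: (eqVneq x v) => [->|xv]; first by rewrite subrr eqxx.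
  rewrite subr0 => /dsum_support[//|/= xv']; by rewrite xv' eqxx in xv.
have la' : dlift embed_simple a' = - (kconst I (c : k) *: v).
  by rewrite (dlift_change embed_simple a'E) raddfB /= a0 dlift_in // sub0r.
have [c0|c0] := eqVneq (c : k) 0.
  have /(congr1 (fun b : dsum S B => dval b)) : a' = 0.
    by apply: Bfree; rewrite la' c0 kconst0 scale0r oppr0.
  rewrite a'E => E; apply: dsumP => x.
  have := congr1 (fun b => b x) E; rewrite dvalB c0 dsum_inE if_same subr0.
  by move=> ->.
case: nv; have [|b bE] := span_scale (- (c : k)^-1) (- (kconst I (c : k) *: v)).
  by exists a'.
exists b; rewrite bE scalerN scalerA kconstM mulNr mulVf // -scaleNr.
have -> : - kconst I (-1) = 1; last by rewrite scale1r.
by apply/eqP; rewrite eq_sym -addr_eq0 -kconst1 -kconstD subrr kconst0.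
Qed.

Lemma pd_le_isotypic n : pd_le n (S : lmodType R) -> pd_le n V.
Proof.
move=> pdS; have [B [Binj Bsurj]] := isotypic_basis.
pose f : {linear dsum S B -> V} := dlift embed_simple.
exact: (pd_le_iso (f := f)) (pd_le_dsum B pdS).
Qed.

End Isotypic.

Variable n : nat.
Hypothesis simple_pd : forall y, pd_le n (simple_left I y : lmodType R).

(** On a module killed by the radical the vertex idempotents act as commuting
    linear projections, so the isotypic parts can be split off one vertex at a
    time. *)
Lemma pd_le_semisimple (V : lmodType R) :
  (forall v : V, rad_kills 1 v) -> pd_le n V.
Proof.
move=> V1.
(* The list s contains the vertices at which W may still be nonzero. *)
suff H (s : seq Q) (W : lmodType R) : (forall v : W, rad_kills 1 v) ->
    (forall x (w : W), x \notin s -> videm I x *: w = 0) -> pd_le n W.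
  by apply: (H (enum Q)) => // x w; rewrite mem_enum.
elim: s W {V V1} => [|y s IH] W W1 Ws.
  apply: pd_le_trivial => w; rewrite -[w]sum_videm_scale big1 // => x _.
  exact: Ws.
have eP (x : Q) a (w : W) :
    a *: (videm I x *: w) = kconst I (vaug x a) *: (videm I x *: w).
  have [r rr E] := mul_videm a x.
  by rewrite scalerA E scalerDl -scalerA (W1 w r rr) addr0.
have eC (x : Q) a (w : W) : videm I x *: (a *: w) = a *: (videm I x *: w).
  have [r rr E] := videm_mul a x.
  by rewrite scalerA E scalerDl -scalerA (W1 w r rr) addr0 -eP.
have el : linear (fun w : W => videm I y *: w).
  by move=> a u v; rewrite scalerDr eC.
have e1l : linear (fun w : W => w - videm I y *: w).
  by move=> a u v; rewrite scalerDr eC scalerBr opprD addrACA.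
have ee (w : W) : videm I y *: (videm I y *: w) = videm I y *: w.
  by rewrite eP vaug_videm eqxx kconst1 scale1r.
have [g gE] : exists g : {linear W -> kermod (linear_of e1l)},
    forall w, kerval (g w) = linear_of el w.
  by apply: kermod_corestr => w /=; rewrite ee subrr.
apply: (pd_le_ext (f := @kerval _ _ _ (linear_of el)) (g := g)).
- exact: kerval_inj.
- move=> w; exists (kerval w); apply: kerval_inj; rewrite gE /=.
  by have /eqP := kermodP w; rewrite /= subr_eq0 => /eqP <-.
- move=> w; split=> [gw|[z <-]].
    by apply: kermod_lift; rewrite -gE gw.
  by apply: kerval_inj; rewrite gE kermodP.
- apply: IH => [w|x w xs].
    apply: (rad_kills_inj (f := @kerval _ _ _ (linear_of el))) => //.
    exact: kerval_inj.
  apply: kerval_inj; have [->|xy] := eqVneq x y; first exact: (kermodP w).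
  by apply: Ws; rewrite inE negb_or xy.
- apply: (pd_le_isotypic (y := y)) (simple_pd y) => a w; apply: kerval_inj.
  have /eqP := kermodP w; rewrite /= subr_eq0 => /eqP wE.
  rewrite -[LHS]/(a *: kerval w) -[RHS]/(kconst I _ *: kerval w) wE.
  exact: eP.
Qed.

(** Filter M by the nilpotent radical: 0 -> J M -> M -> M / J M -> 0. *)
Lemma pd_le_all (M : lmodType R) : pd_le n M.
Proof.
have [m Rm] := rad_nilpotent I.
suff H (i : nat) (N : lmodType R) : (forall u : N, rad_kills i u) -> pd_le n N.
  exact: (H m).
elim: i N {M} => [|i IH] N Ni; first exact: pd_le_trivial.
have [L [p [ps pE]]] := quotient_exists (rad_module N).
apply: (pd_le_ext (f := @kerval _ _ _ p) (g := p)) => //.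
- exact: kerval_inj.
- move=> x; split=> [/kermod_lift//|[z <-]]; exact: kermodP.
- apply: IH => u; apply: (rad_kills_inj (f := @kerval _ _ _ p)).
    exact: kerval_inj.
  by apply: rad_module_kills => //; apply/pE/kermodP.
- apply: pd_le_semisimple => v a ra; have [x <-] := ps v.
  by rewrite -linearZ; apply/pE/rad_moduleZ.
Qed.

End SemisimpleModules.

Lemma finite_set_bound (A : set nat) :
  finite_set A -> exists N, forall n, A n -> (n < N)%N.
Proof.
move=> /finite_seqP[s ->]; exists (\max_(i <- s) i).+1 => n /= ns.
by rewrite ltnS; apply: (@leq_bigmax_seq _ s xpredT id n).
Qed.

(** If all the Tor between simples were finite, a common bound N on their
    degrees would exist, there being finitely many vertices.  The N-th syzygies
    of the simples would be projective, so N would bound every projective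
    dimension. *)
Lemma infinite_Tor (k : fieldType) (Q : quiver) (I : admissible_ideal k Q) :
  infinite_gldim (bqa I) ->
  exists x y : Q, graded_infinite (Tor (simple_right I x) (simple_left I y)).
Proof.
move=> inf; apply: contrapT => fin; apply: inf.
pose nz (xy : Q * Q) n :=
  exists v : Tor (simple_right I xy.1) (simple_left I xy.2) n, v != 0.
have bound xy : exists N, forall n, nz xy n -> (n < N)%N.
  apply: finite_set_bound; apply: contrapT => infT; apply: fin.
  by exists xy.1, xy.2.
pose b xy := sval (cid (bound xy)).
have bP xy n : nz xy n -> (n < b xy)%N by rewrite /b; case: cid => /= N; apply.
pose N := (\max_xy b xy)%N; exists N => M.
apply/pd_le_proj_dim/pd_le_all => y.
apply/pd_le_syzygy/syzygy_projective_of_Tor.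
move=> x v; apply/eqP; apply: contraT => v0.
have := bP (x, y) N.+1 (ex_intro _ v v0).
by rewrite ltnNge leqW // leq_bigmax.
Qed.

Theorem proposition6p8 (k : fieldType) (Q : quiver) (I : admissible_ideal k Q)
    (gldimI : infinite_gldim (bqa I)) :
  ((forall y x : Q, corner_nonzero I y x /\ corner_nonzero I x y) ->
     infinite_plus_gldim I /\ infinite_coplus_gldim I)
  /\
  ((forall y x : Q, corner_nonzero I y x \/ corner_nonzero I x y) ->
     infinite_plus_gldim I \/ infinite_coplus_gldim I).
Proof.
have [x [y Txy]] := infinite_Tor gldimI; split=> corner.
  have [cyx cxy] := corner y x.
  by split; [exists y, x | exists x, y].
by have [cyx|cxy] := corner y x; [left; exists y, x | right; exists x, y].
Qed.
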